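(* Let $A\in\mathbb{R}^{n\times d}$ with $n<d$ have full row rank, let $b\in\mathbb{R}^n$ with $b\neq0$, let $f(x):=\|x\|_2^2$ and $x^*:=\arg\min_{x\in\mathbb{R}^d}\{\|x\|_2^2:\ Ax=b\}$. Let $m>n+1$, $q\ge1$, let $S_1,\dots,S_q\in\mathbb{R}^{m\times d}$ be i.i.d. Gaussian sketches, and set $$\hat{z}_k:=\arg\min_{z\in\mathbb{R}^m}\{\|z\|_2^2:\ AS_k^Tz=b\},\qquad \hat{x}_k:=S_k^T\hat{z}_k,\qquad \bar{x}:=\frac1q\sum_{k=1}^q\hat{x}_k.$$ Then $$\frac{\mathbb{E}[f(\bar{x})]-f(x^* )}{f(x^* )}=\frac1q\,\frac{d-n}{m-n-1}.$$ Consequently, for every $\epsilon>0$, $\frac{f(\bar{x})-f(x^* )}{f(x^* )}\le\epsilon$ holds with probability at least $1-\frac{1}{q\epsilon}\frac{d-n}{m-n-1}$.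
   Context: A Gaussian sketch here is a random matrix $S\in\mathbb{R}^{m\times d}$ with i.i.d. entries distributed as $\mathcal{N}(0,1/m)$, so that $\mathbb{E}[S^TS]=I_d$. Expectations and probabilities are over the sketches only. *)

(* Defs.v *)
From HB Require Import structures.
From mathcomp Require Export all_boot all_order all_algebra.
From mathcomp Require Export all_classical all_reals all_analysis.

Set Implicit Arguments.
Unset Strict Implicit.
Unset Printing Implicit Defensive.

Export Order.TTheory GRing.Theory Num.Theory.
Export numFieldNormedType.Exports.

Local Open Scope classical_set_scope.
Local Open Scope ring_scope.

(* The squared Euclidean norm; [`|x|] on matrices is the sup norm. *)
Definition sqnorm2 (R : realType) (p : nat) (x : 'cV[R]_p) : R :=
  \sum_(i < p) x i ord0 ^+ 2.

Definition is_argmin (R : realType) (V : Type) (C : set V) (g : V -> R)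
    (x : V) : Prop :=
  C x /\ forall y, C y -> g x <= g y.

(* The minimizer of ||x||_2^2 subject to M x = b, unique as soon as M x = b
   is solvable; it is 0 by convention when M x = b has no solution. *)
Definition min_norm_sol (R : realType) (n p : nat) (M : 'M[R]_(n, p))
    (b : 'cV[R]_n) : 'cV[R]_p :=
  xget 0 [set x | is_argmin [set y | M *m y = b] (@sqnorm2 R p) x].

Definition mutually_independent (disp : measure_display)
    (T : measurableType disp) (R : realType) (P : probability T R)
    (I : finType) (F : I -> set (set T)) : Prop :=
  forall (J : {set I}) (E : I -> set T),
    (forall i, i \in J -> F i (E i)) ->
    P (\bigcap_(i in [set i | i \in J]) E i) = (\prod_(i in J) P (E i))%E.

(* The events determined by a real function X, i.e., the sigma-algebra
   generated by X. *)
Definition sigma_fun (T : Type) (R : realType) (X : T -> R) : set (set T) :=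
  preimage_set_system setT X measurable.

(* The sigma-algebra generated by a random matrix, that is, by its entries. *)
Definition sigma_mx (T : Type) (R : realType) (m d : nat)
    (S : T -> 'M[R]_(m, d)) : set (set T) :=
  <<s \bigcup_(ij in [set: 'I_m * 'I_d]) sigma_fun (fun w => S w ij.1 ij.2) >>.

(* The second parameter of [normal_prob] is the standard deviation. *)
Definition gaussian_sketch (disp : measure_display) (T : measurableType disp)
    (R : realType) (P : probability T R) (m d : nat)
    (S : T -> 'M[R]_(m, d)) : Prop :=
  [/\ forall i j, measurable_fun setT (fun w => S w i j),
      forall i j (B : set R), measurable B ->
        P ((fun w => S w i j) @^-1` B) = normal_prob 0 (Num.sqrt m%:R^-1) B
    & mutually_independent P
        (fun ij : 'I_m * 'I_d => sigma_fun (fun w => S w ij.1 ij.2))].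

(* The sketches are identically distributed because every [S k] is a Gaussian
   sketch of the same size. *)
Definition iid_gaussian_sketches (disp : measure_display)
    (T : measurableType disp) (R : realType) (P : probability T R)
    (q m d : nat) (S : 'I_q -> T -> 'M[R]_(m, d)) : Prop :=
  (forall k, gaussian_sketch P (S k)) /\
  mutually_independent P (fun k => sigma_mx (S k)).

(* Main.v *)
Require Import Defs.
From mathcomp Require Import measurable_realfun.
From mathcomp Require Import ring lra.

Set Implicit Arguments.
Unset Strict Implicit.
Unset Printing Implicit Defensive.
Set Bullet Behavior "Strict Subproofs".

Local Open Scope classical_set_scope.
Local Open Scope ring_scope.

(** Write B_k = A S_k^T, z_k for the minimum-norm solution of B_k z = b,
K = A A^T, s^2 = 1/m for the variance of the entries, and
Q = 1 - A^T K^-1 A for the orthogonal projection onto the kernel of A.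
Almost surely every B_k B_k^T is invertible; then A xbar = b, so that
xbar = xstar + Q xbar is an orthogonal decomposition and
f(xbar) = f(xstar) + |Q xbar|^2 ([sqnorm2_kernel_decomp]). As
Q xbar = q^-1 sum_k Q S_k^T z_k, everything reduces to the two facts

- E <Q S_k^T z_k, Q S_k'^T z_k'> = [k = k'] s^2 (d - n) E |z_k|^2
  ([mean_cross]),
- (m - n - 1) s^2 E |z_k|^2 = b^T K^-1 b = f(xstar), where
  |z_k|^2 = b^T (B_k B_k^T)^-1 b ([mean_sqnorm2_zhat]).

The usual derivation of these facts goes through the rotation invariance of
the Gaussian law (Q S^T is independent of A S^T) and the mean of the inverse
Wishart distribution. Here both come from Gaussian integration by parts:
E[X_i F(X)] = s^2 E[d_i F(X)] for independent X_i of law N(0, s^2) ([stein]).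
If F depends on the sketches only through the matrices B_k, its derivatives in
the directions of the kernel of A vanish, which gives the first fact
([stein_orthogonal]). Applied to F = B^T (B B^T)^-1 b, whose divergence with
respect to B is explicit, integration by parts gives the second one
([mean_inverse_wishart]).

The inverse of B B^T is not a smooth function of the sketch, so it is replaced
by N_e = (B B^T + e)^-1 with e > 0, whose entries are bounded and smooth; the
limit e -> 0 is taken at the end. The identity for N_e bounds E tr N_e
uniformly in e, whereas e tr N_e >= 1 wherever B B^T is singular: hence
singularity has probability 0 ([sketched_unit_ae]). By Fatou, |z_k|^2 and
|S_k Q|_F^2 |z_k|^2 are integrable, and they dominate all the terms whose limit
is needed.

The function that sends B to the minimum-norm solution is measurable even where
B B^T is singular, being a limit of regularized solutions where the system is
solvable and 0 elsewhere ([mx_measurable_min_norm_sol]). This makes the event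
of the last claim measurable, and the claim is Markov's inequality for
|Q xbar|^2 / f(xstar). *)

(** * Mean-zero random variables *)

Section mean_zero.
Context {disp : measure_display} {T : measurableType disp} {R : realType}.
Variable P : probability T R.

Definition integrableR (f : T -> R) : Prop := P.-integrable setT (EFin \o f).

(** Identities between expectations are stated as [mean_zero] of a difference:
such functions form a vector space, so that identities combine by pointwise
algebra without separate integrability conditions. *)
Definition mean_zero (f : T -> R) : Prop :=
  integrableR f /\ \int[P]_w f w = 0.

Lemma integrableR_ext (f g : T -> R) :
  f =1 g -> integrableR f -> integrableR g.
Proof. by move=> /funext ->. Qed.

Lemma integrableR_meas f : integrableR f -> measurable_fun setT f.
Proof. by move=> /measurable_int/measurable_EFinP. Qed.

Lemma integrableR_cst c : integrableR (fun=> c).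
Proof. exact: finite_measure_integrable_cst. Qed.

Lemma integrableRZ c f : integrableR f -> integrableR (fun w => c * f w).
Proof.
move=> fi; rewrite /integrableR.
rewrite (_ : EFin \o _ = fun w => (c%:E * (EFin \o f) w)%E); last exact/funext.
exact: integrableZl.
Qed.

Lemma integrableRD f g :
  integrableR f -> integrableR g -> integrableR (fun w => f w + g w).
Proof.
move=> fi gi; rewrite /integrableR.
rewrite (_ : EFin \o _ = (EFin \o f) \+ (EFin \o g))%E; last exact/funext.
exact: integrableD.
Qed.

Lemma integrableR_sum (I : finType) (f : I -> T -> R) :
  (forall i, integrableR (f i)) -> integrableR (fun w => \sum_i f i w).
Proof.
move=> fi; elim: (index_enum I) => [|i s IH].
  by apply: (integrableR_ext (f := fun=> 0)) (integrableR_cst 0) => w; rewrite big_nil.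
apply: (integrableR_ext (f := fun w => f i w + \sum_(j <- s) f j w)).
  by move=> w; rewrite big_cons.
exact: integrableRD.
Qed.

Lemma integrableR_le (f g : T -> R) : measurable_fun setT f ->
  (forall w, `|f w| <= g w) -> integrableR g -> integrableR f.
Proof.
move=> mf fg; apply: le_integrable => //; first exact/measurable_EFinP.
by move=> w _ /=; rewrite lee_fin (le_trans (fg w))// ler_norm.
Qed.

Lemma mean_zero_ext f g : f =1 g -> mean_zero f -> mean_zero g.
Proof. by move=> /funext ->. Qed.

Lemma mean_zero0 : mean_zero (fun=> 0).
Proof.
by split; [exact: integrableR_cst | rewrite Rintegral_cst// mul0r].
Qed.

Lemma mean_zeroZ c f : mean_zero f -> mean_zero (fun w => c * f w).
Proof.
move=> [fi f0]; split; first exact: integrableRZ.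
by rewrite RintegralZl// f0 mulr0.
Qed.

Lemma mean_zeroD f g :
  mean_zero f -> mean_zero g -> mean_zero (fun w => f w + g w).
Proof.
move=> [fi f0] [gi g0]; split; first exact: integrableRD.
by rewrite RintegralD// f0 g0 addr0.
Qed.

Lemma mean_zero_sum (I : finType) (f : I -> T -> R) :
  (forall i, mean_zero (f i)) -> mean_zero (fun w => \sum_i f i w).
Proof.
move=> fi; elim: (index_enum I) => [|i s IH].
  by apply: mean_zero_ext mean_zero0 => w; rewrite big_nil.
apply: (mean_zero_ext (f := fun w => f i w + \sum_(j <- s) f j w)).
  by move=> w; rewrite big_cons.
exact: mean_zeroD.
Qed.

Lemma mean_zeroP c f : mean_zero (fun w => f w - c) ->
  integrableR f /\ (\int[P]_w (f w)%:E = c%:E)%E.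
Proof.
move=> [fi f0].
have fint : integrableR f.
  apply: (integrableR_ext (f := fun w => (f w - c) + c)); first by move=> w; rewrite subrK.
  exact: integrableRD (integrableR_cst c).
split => //; move: f0; rewrite RintegralB//; last exact: integrableR_cst.
rewrite Rintegral_cst// (_ : fine (P setT) = 1) ?mulr1; last by rewrite probability_setT.
move/eqP; rewrite subr_eq0 => /eqP <-.
by rewrite /Rintegral fineK//; exact: integrable_fin_num.
Qed.

Lemma mean_zero_lim (f_ : nat -> T -> R) (f g : T -> R) :
  (forall n, mean_zero (f_ n)) -> measurable_fun setT f ->
  integrableR g ->
  {ae P, forall w, f_ ^~ w @ \oo --> f w} ->
  {ae P, forall w, forall n, `|f_ n w| <= g w} ->
  mean_zero f.
Proof.
move=> f0 mf ig cv le.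
have := @dominated_convergence _ _ _ P setT measurableT
  (fun n => EFin \o f_ n) (EFin \o f) (EFin \o g).
case.
- by move=> n; apply/measurable_EFinP; apply: integrableR_meas; case: (f0 n).
- exact/measurable_EFinP.
- by move: cv; apply: filterS => w /= cv _; apply: cvg_EFin => //; exact: nearW.
- exact: ig.
- by move: le; apply: filterS => w /= le n _; rewrite lee_fin.
- move=> fi _ cvI; split => //.
  rewrite /Rintegral.
  suff -> : (\int[P]_w (f w)%:E = 0)%E by [].
  have e : (fun n => \int[P]_w (EFin \o f_ n) w)%E = (fun=> 0)%E.
    apply/funext => n /=; have [fni fn0] := f0 n.
    rewrite -[LHS]fineK; first by move: fn0; rewrite /Rintegral /= => ->.
    exact: integrable_fin_num.
  have {}cvI : (fun n => \int[P]_w (EFin \o f_ n) w)%E @ \oo -->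
    (\int[P]_w (f w)%:E)%E := cvI.
  by rewrite e in cvI; apply: cvg_unique cvI _ => //; exact: cvg_cst.
Qed.

(** Fatou's lemma as a source of integrability for a limit. *)
Lemma integrableR_fatou (f_ : nat -> T -> R) (f : T -> R) (C : R) :
  (forall n, integrableR (f_ n)) -> (forall n w, 0 <= f_ n w) ->
  (forall n, \int[P]_w f_ n w <= C) -> measurable_fun setT f ->
  {ae P, forall w, f_ ^~ w @ \oo --> f w} -> integrableR f.
Proof.
move=> fi f0 fC mf cv.
have fa := @fatou _ _ _ P setT measurableT (fun n => EFin \o f_ n) _ _.
have {}fa : (\int[P]_w limn_einf (fun n => (f_ n w)%:E) <= C%:E)%E.
  apply: le_trans (fa _ _) _.
      by move=> n; apply/measurable_EFinP; exact: integrableR_meas.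
    by move=> n w _; rewrite lee_fin.
  rewrite limn_einf_lim; apply: lime_le.
    by apply: is_cvg_einfs.
  apply: nearW => n; rewrite /einfs /=.
  apply: le_trans (_ : (\int[P]_w (f_ n w)%:E <= _)%E).
    by apply: ereal_inf_lbound; exists n => /=.
  rewrite -[leLHS]fineK; first by rewrite lee_fin; exact: fC.
  by apply: integrable_fin_num => //; exact: fi.
apply/integrableP; split; first exact/measurable_EFinP.
apply: le_lt_trans (ltry C); apply: le_trans fa.
rewrite le_eqVlt; apply/orP; left; apply/eqP.
apply: ae_eq_integral => //.
    by apply: measurableT_comp => //; exact/measurable_EFinP.
  rewrite (_ : (fun w => _) =
      (fun w => - limn_esup (-%E \o (fun n => (f_ n w)%:E)))%E); last first.
    apply/funext => w; rewrite -limn_einfN; congr limn_einf.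
    by apply/funext => n /=; rewrite opprK.
  apply: measurableT_comp => //.
  apply: (@measurable_fun_limn_esup _ _ _ _ (fun n w => - (f_ n w)%:E)%E) => n.
  apply: measurableT_comp => //.
  by apply/measurable_EFinP; exact: integrableR_meas.
move: cv; apply: filterS => w /= cv _.
have cvE : (f_ n w)%:E @[n --> \oo] --> (f w)%:E by apply: cvg_EFin => //; exact: nearW.
have /cvg_limn_einf_sup := cvE; case=> -> _.
rewrite /= ger0_norm// -(cvg_lim _ cv)//.
by apply: limr_ge; [apply/cvg_ex; exists (f w)|exact: nearW].
Qed.

Lemma Rintegral_le_mean_zero (f g : T -> R) (C : R) :
  integrableR f -> mean_zero g -> (forall w, f w <= C - g w) ->
  \int[P]_w f w <= C.
Proof.
move=> fi [gi g0] le.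
have -> : C = \int[P]_w (C + -1 * g w).
  rewrite RintegralD//; [|exact: integrableR_cst|exact: integrableRZ].
  rewrite RintegralZl// g0 mulr0 addr0 Rintegral_cst// (_ : fine (P setT) = 1) ?mulr1//.
  by rewrite probability_setT.
apply: le_Rintegral => //.
  by apply: integrableRD; [exact: integrableR_cst|exact: integrableRZ].
by move=> w _; rewrite mulN1r.
Qed.

Lemma integrableR_bounded (f : T -> R) (C : R) : measurable_fun setT f ->
  (forall w, `|f w| <= C) -> integrableR f.
Proof. by move=> mf fC; apply: (integrableR_le mf fC); exact: integrableR_cst. Qed.

End mean_zero.

Lemma markov_mean_zero {disp : measure_display} {T : measurableType disp}
  {R : realType} (P : probability T R) (g : T -> R) (c eps : R) :
  0 < eps -> (forall w, 0 <= g w) -> mean_zero P (fun w => g w - c) ->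
  ((1 - eps^-1 * c)%:E <= P [set w | (g w <= eps)%R])%E.
Proof.
move=> eps0 g0 mz; have [gi gE] := mean_zeroP mz.
have mg : measurable_fun setT g by exact: integrableR_meas gi.
have mA : measurable [set w | g w <= eps].
  by rewrite -[X in measurable X]setTI; exact: measurable_fun_le.
rewrite -[P _]fineK ?fin_num_measure// lee_fin.
have -> : fine (P [set w | g w <= eps]) = \int[P]_w \1_[set w | g w <= eps] w.
  by rewrite /Rintegral integral_indic// setIT.
have -> : 1 - eps^-1 * c = \int[P]_w (1 + - eps^-1 * g w).
  rewrite RintegralD//; [|exact: integrableR_cst|exact: integrableRZ].
  rewrite RintegralZl// Rintegral_cst// (_ : fine (P setT) = 1) ?mulr1; last by rewrite probability_setT.
  by rewrite /Rintegral gE /= mulNr.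
apply: le_Rintegral => //.
- by apply: integrableRD; [exact: integrableR_cst|exact: integrableRZ].
- apply: (@integrableR_bounded _ _ _ P _ 1); first exact: measurable_indic.
  by move=> w; rewrite indicE; case: (_ \in _); rewrite ?normr1 ?normr0.
- move=> w _; rewrite indicE mulNr; case: (boolP (w \in _)) => hw.
    by rewrite gerDl oppr_le0 mulr_ge0// invr_ge0 ltW.
  rewrite subr_le0 ler_pdivlMl// mulr1; apply: ltW; rewrite ltNge.
  by apply: contra hw => hw; rewrite inE.
Qed.

Lemma ae_eq_probability {disp : measure_display} {T : measurableType disp}
  {R : realType} (P : probability T R) (A B : set T) :
  measurable A -> measurable B -> {ae P, forall w, A w <-> B w} -> P A = P B.
Proof.
move=> mA mB AB; rewrite -[A]setIT -[B]setIT -!integral_indic//.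
apply: ae_eq_integral => //.
- by apply/measurable_EFinP; exact: measurable_indic.
- by apply/measurable_EFinP; exact: measurable_indic.
- move: AB; apply: filterS => w AB _; rewrite !indicE.
  by rewrite (_ : (w \in A) = (w \in B))//; apply/idP/idP; rewrite !inE => /AB.
Qed.

(** * Integration by parts for one Gaussian variable *)

Section gaussian.
Context {R : realType}.
Variable s : R.
Hypothesis s0 : s != 0.
Local Notation N := (normal_prob 0 s).
Local Notation p := (normal_pdf 0 s).
Local Notation mu := (@lebesgue_measure R).

Lemma integral_normal_prob (f : R -> \bar R) : N.-integrable setT f ->
  (\int[N]_x f x = \int[mu]_x (f x * (p x)%:E))%E.
Proof.
move=> fi; have dom := normal_prob_dominates (0 : R) s.
rewrite -(Radon_Nikodym_change_of_variables dom)//=.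
apply: ae_eq_integral => //.
- apply: emeasurable_funM => //; first exact: measurable_int fi.
- apply: emeasurable_funM => //=; first exact: measurable_int fi.
  by apply/measurable_EFinP; exact: measurable_normal_pdf.
- apply: ae_eqe_mul2l => /=.
  rewrite Radon_NikodymE//=; case: cid => /= h [h1 h2 h3].
  apply: integral_ae_eq => //=.
  + by apply/measurable_EFinP; exact: measurable_normal_pdf.
  + by move=> E ET mE; rewrite -h3.
Qed.

(** A square is absorbed by passing from the standard deviation s to
sqrt 2 s, since u exp(-u) <= 1. *)
Lemma normal_pdf_sqr_le :
  exists2 c, 0 <= c & forall t : R, t ^+ 2 * p t <= c * normal_pdf 0 (Num.sqrt 2 * s) t.
Proof.
have s2 : 0 < s ^+ 2 by rewrite exprn_even_gt0.
have r2 : Num.sqrt 2 * s != 0 by rewrite mulf_neq0// sqrtr_eq0 -ltNge ltr0n.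
have q0 := normal_peak_gt0 r2; have p0 := normal_peak_gt0 s0.
exists (4 * s ^+ 2 * normal_peak s / normal_peak (Num.sqrt 2 * s)).
  by apply: divr_ge0 (ltW q0); apply: mulr_ge0 (ltW p0); apply: mulr_ge0 (ltW s2).
move=> t; rewrite !normal_pdfE//.
rewrite [leRHS](_ : _ = 4 * s ^+ 2 * normal_peak s * normal_fun 0 (Num.sqrt 2 * s) t); last first.
  by field; rewrite gt_eqF.
rewrite /normal_fun !subr0 exprMn sqr_sqrtr//.
set u := t ^+ 2 / (4 * s ^+ 2).
have -> : - t ^+ 2 / (s ^+ 2 *+ 2) = - u - u by rewrite /u; field.
have -> : - t ^+ 2 / (2 * s ^+ 2 *+ 2) = - u by rewrite /u; field.
have -> : t ^+ 2 = 4 * s ^+ 2 * u by rewrite /u; field.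
rewrite expRD.
have e0 := expR_gt0 (- u).
have ue : u * expR (- u) <= 1.
  rewrite expRN ler_pdivrMr ?expR_gt0// mul1r.
  by apply: le_trans _ (expR_ge1Dx u); rewrite lerDr ler01.
have : 0 <= 4 * s ^+ 2 * normal_peak s * expR (- u) * (1 - u * expR (- u)).
  apply: mulr_ge0; rewrite ?subr_ge0//; apply: mulr_ge0 (ltW e0).
  by apply: mulr_ge0 (ltW p0); apply: mulr_ge0 (ltW s2).
nra.
Qed.

(** The density formula [integral_normal_prob] requires integrability; it is
applied to the truncations min(t^2, k), and Fatou concludes. *)
Lemma normal_integrable_sqr : integrableR N (fun t => t ^+ 2).
Proof.
have [c c0 hc] := normal_pdf_sqr_le.
pose h n (t : R) := Num.min (t ^+ 2) n%:R.
have mh n : measurable_fun setT (h n).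
  by apply: measurable_minr => //; exact: measurable_funX.
have hb n t : 0 <= h n t <= n%:R.
  by rewrite /h le_min sqr_ge0 ler0n/= ge_min lexx orbT.
have hi n : integrableR N (h n).
  apply: (@integrableR_le _ _ _ N (h n) (fun=> n%:R) _ _ (integrableR_cst N n%:R)) => [|w].
    exact: mh.
  by have /andP[a b] := hb n w; rewrite ger0_norm//.
apply: (@integrableR_fatou _ _ _ N h (fun t => t ^+ 2) c).
- exact: hi.
- by move=> n w; case/andP: (hb n w).
- move=> n; rewrite /Rintegral integral_normal_prob; last exact: hi.
  have e : (\int[mu]_x (c * normal_pdf 0 (Num.sqrt 2 * s) x)%:E = c%:E)%E.
    under eq_integral do rewrite EFinM.
    by rewrite integralZl//= ?integral_normal_pdf ?mule1//; exact: integrable_normal_pdf.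
  have le : (\int[mu]_x ((h n x)%:E * (p x)%:E) <= c%:E)%E.
    { rewrite -e; apply: ge0_le_integral => //=.
    + by move=> x _; rewrite -EFinM lee_fin mulr_ge0 ?normal_pdf_ge0//; case/andP: (hb n x).
    + apply: emeasurable_funM; apply/measurable_EFinP .
      * exact: mh.
      * exact: measurable_normal_pdf.
    + by apply/measurable_EFinP/measurable_funM => //; exact: measurable_normal_pdf.
    + move=> x _; rewrite -EFinM lee_fin; apply: le_trans (hc x).
      by rewrite ler_wpM2r ?normal_pdf_ge0// /h ge_min lexx. }
  rewrite -lee_fin fineK//.
  rewrite ge0_fin_numE; first exact: le_lt_trans le (ltry _).
  by apply: integral_ge0 => x _; rewrite -EFinM lee_fin mulr_ge0 ?normal_pdf_ge0//; case/andP: (hb n x).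
- exact: measurable_funX.
- apply: aeW => t; apply: cvg_near_cst.
  have hk := archi_boundP (sqr_ge0 t).
  near=> n; rewrite /h /=; apply/min_idPl; apply: le_trans (ltW hk) _.
  by rewrite ler_nat; near: n; exact: nbhs_infty_ge.
Unshelve. all: by end_near. Qed.

Lemma normal_integrable_quadratic (f : R -> R) (C : R) :
  measurable_fun setT f -> (forall t, `|f t| <= C * (1 + t ^+ 2)) ->
  integrableR N f.
Proof.
move=> mf fC.
apply: (@integrableR_le _ _ _ N f (fun t => C * (1 + t ^+ 2))).
- exact: mf.
- exact: fC.
- apply: (@integrableRZ _ _ _ N); apply: (@integrableRD _ _ _ N).
  + exact: (@integrableR_cst _ _ _ N).
  + exact: normal_integrable_sqr.
Qed.

Lemma is_derive_normal_pdf (t : R) : is_derive t 1 p (- (t / s ^+ 2) * p t).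
Proof.
rewrite normal_pdfE//.
have -> : normal_fun 0 s = expR \o (fun x : R => (- (s ^+ 2 *+ 2)^-1) * x ^+ 2).
  by apply/funext => x; rewrite /normal_fun /= subr0 mulrC mulrN mulNr.
have d1 : is_derive t 1 (fun x : R => (- (s ^+ 2 *+ 2)^-1) * x ^+ 2) (- (t / s ^+ 2)).
  apply: (@is_derive_eq _ _ _ (cst (- (s ^+ 2 *+ 2)^-1) * (@id R) ^+ 2)).
  rewrite /= /cst /GRing.scale /= !fctE mulr0 addr0.
  by field.
have d2 := is_derive1_comp (is_derive_expR _) d1.
apply: (@is_derive_eq _ _ _ (cst (normal_peak s) * (expR \o (fun x : R => (- (s ^+ 2 *+ 2)^-1) * x ^+ 2)))).
rewrite /= /GRing.scale /= /cst; ring.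
Qed.

(** Makes the boundary terms of the integration by parts vanish. *)
Lemma normal_pdf_decay :
  exists D : R, forall t : R, 1 <= t -> (1 + t) * p t <= D / t.
Proof.
have s2 : 0 < s ^+ 2 by rewrite exprn_even_gt0.
have p0 := normal_peak_gt0 s0.
exists (4 * s ^+ 2 * normal_peak s) => t t1.
have tp : 0 < t by apply: lt_le_trans t1.
rewrite normal_pdfE// /normal_fun subr0.
set u := t ^+ 2 / (2 * s ^+ 2).
have -> : - t ^+ 2 / (s ^+ 2 *+ 2) = - u by rewrite /u; field.
have u0 : 0 < u by apply: divr_gt0; [exact: exprn_gt0|exact: mulr_gt0].
have e0 := expR_gt0 (- u).
have ue : u * expR (- u) <= 1.
  rewrite expRN ler_pdivrMr ?expR_gt0// mul1r.
  by apply: le_trans _ (expR_ge1Dx u); rewrite lerDr ler01.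
rewrite ler_pdivlMr//.
apply: (@le_trans _ _ (2 * t ^+ 2 * (normal_peak s * expR (- u)))).
  rewrite mulrAC ler_wpM2r ?mulr_ge0 ?(ltW p0) ?(ltW e0)//.
  by nra.
have -> : t ^+ 2 = 2 * s ^+ 2 * u by rewrite /u; field.
rewrite (_ : _ * _ = 4 * s ^+ 2 * normal_peak s * (u * expR (- u))); last by ring.
by rewrite ler_piMr// mulr_ge0 ?(ltW p0)// mulr_ge0 ?(ltW s2).
Qed.

(** The integrand times the density is - s^2 times the derivative of f times the
density. By the fundamental theorem of calculus its integral over [-a, a] is
a boundary term, which tends to 0 with a to infinity. *)
Lemma stein_normal (f g : R -> R) (C : R) :
  (forall t : R, is_derive t 1 f (g t)) -> continuous g ->
  (forall t, `|f t| <= C * (1 + `|t|)) ->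
  (forall t, `|g t| <= C * (1 + `|t|)) ->
  mean_zero N (fun t => t * f t - s ^+ 2 * g t).
Proof.
move=> df cg fC gC.
have s2 : 0 < s ^+ 2 by rewrite exprn_even_gt0.
have C0 : 0 <= C.
  by have := fC 0; rewrite normr0 addr0 mulr1; exact: le_trans.
have cf : continuous f.
  by move=> t; apply: differentiable_continuous; apply/derivable1_diffP; case: (df t).
pose h (t : R) := t * f t - s ^+ 2 * g t.
have ch : continuous h.
  { move=> t; apply: cvgB; apply: cvgM.
  - exact: cvg_id.
  - exact: cf.
  - exact: cvg_cst.
  - exact: cg. }
have mh : measurable_fun setT h by exact: continuous_measurable_fun.
have hb t : `|h t| <= (2 * C + 2 * C * s ^+ 2) * (1 + t ^+ 2).
  rewrite /h; apply: le_trans (ler_normB _ _) _.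
  rewrite (normrM t) (normrM (s ^+ 2)) (ger0_norm (ltW s2)) -(real_normK (num_real t)).
  have := fC t; have := gC t; set a := `|t|; set x := `|f t|; set y := `|g t|.
  have a0 : 0 <= a by exact: normr_ge0.
  move=> yC xC.
  have h1 : a * x <= a * (C * (1 + a)) by rewrite ler_wpM2l.
  have h2 : s ^+ 2 * y <= s ^+ 2 * (C * (1 + a)) by exact: ler_wpM2l (ltW s2) _ _ yC.
  apply: (le_trans (lerD h1 h2)).
  have q1 : a * (1 + a) <= 2 * (1 + a ^+ 2) by nra.
  have q2 : 1 + a <= 2 * (1 + a ^+ 2) by nra.
  have q3 := ler_wpM2l C0 q1.
  have q4 := ler_wpM2l (mulr_ge0 C0 (ltW s2)) q2.
  nra.
have hi : integrableR N h by exact: normal_integrable_quadratic hb.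
have ip : (mu.-integrable setT (fun t => (h t * p t)%:E)).
  apply/integrableP; split.
    by apply/measurable_EFinP/measurable_funM => //; exact: measurable_normal_pdf.
  have ni : N.-integrable setT (fun t => `|(h t)%:E|%E) by exact: integrable_abse.
  rewrite (_ : integral _ _ _ = \int[N]_t `|(h t)%:E|)%E.
    by move/integrableP : hi => [].
  rewrite integral_normal_prob//; apply: eq_integral => t _.
  by rewrite /= normrM (ger0_norm (normal_pdf_ge0 _ _ _)).
pose H (t : R) := f t * p t.
have cp : continuous p by exact: continuous_normal_pdf.
have dH (t : R) : is_derive t 1 H (- (s ^- 2 * (h t * p t))).
  have dp := is_derive_normal_pdf t.
  have dft := df t.
  apply: (@is_derive_eq _ _ _ (f * p)).
  by rewrite /GRing.scale /= /h; field.
pose a (n : nat) : R := n.+1%:R.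
have a0 n : 0 < a n by rewrite ltr0n.
have ftc n : (\int[mu]_(t in `[(- a n)%R, a n]) (- (s ^- 2 * (h t * p t)))%:E
    = (H (a n))%:E - (H (- a n))%:E)%E.
  { apply: continuous_FTC2.
  - by rewrite gtrN.
  - apply: continuous_subspaceT => t; apply: cvgN; apply: cvgM; first exact: cvg_cst.
    by apply: cvgM; [exact: ch|exact: cp].
  - have cH : continuous H by move=> t; apply: cvgM; [exact: cf|exact: cp].
    split.
    + by move=> t _; case: (dH t).
    + by apply: cvg_at_right_filter; exact: cH.
    + by apply: cvg_at_left_filter; exact: cH.
  - by move=> t _; rewrite derive1E; case: (dH t). }
have ftc' n : \int[mu]_(t in `[(- a n)%R, a n]) (h t * p t)
    = - (s ^+ 2) * (H (a n) - H (- a n)).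
  have ii : mu.-integrable `[(- a n)%R, a n] (EFin \o (fun t => h t * p t)).
    by apply: integrableS ip.
  have := congr1 fine (ftc n); rewrite -EFinB /= => <-.
  rewrite -RintegralZl//.
    apply: eq_Rintegral => t _; by field.
  rewrite (_ : EFin \o _ = (fun t => (- s ^-2)%:E * (h t * p t)%:E)%E).
    exact: integrableZl.
  by apply/funext => t; rewrite /= -EFinM mulNr.
split; first exact: hi.
rewrite /Rintegral integral_normal_prob//.
have [D hD] := normal_pdf_decay.
have Hb (t : R) : 1 <= `|t| -> `|H t| <= C * D / `|t|.
  move=> t1; rewrite /H normrM (ger0_norm (normal_pdf_ge0 _ _ _)).
  (* the density is even *)
  have -> : p t = p `|t|.
    by rewrite normal_pdfE// /normal_fun !subr0 real_normK// num_real.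
  apply: (@le_trans _ _ (C * (1 + `|t|) * p `|t|)).
    by rewrite ler_wpM2r ?normal_pdf_ge0.
  by rewrite -!mulrA ler_wpM2l//; exact: hD.
pose D_ n : set R := `[(- a n)%R, a n]%classic.
pose F n (t : R) := ((fun t => (h t * p t)%:E) \_ (D_ n)) t.
have mhp : measurable_fun setT (fun t => (h t * p t)%:E).
  by apply/measurable_EFinP/measurable_funM => //; exact: measurable_normal_pdf.
have mD n : measurable (D_ n) by exact: measurable_itv.
have Fabs n t : (`|F n t| <= `|(h t * p t)%:E|)%E.
  rewrite /F patchE; case: ifP => // _; by rewrite abse0 abse_ge0.
have cvF : (\int[mu]_t F n t)%E @[n --> \oo] --> (\int[mu]_t (h t * p t)%:E)%E.
  {  have := @dominated_convergence _ _ _ mu setT measurableT F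
    (fun t => (h t * p t)%:E) (fun t => `|(h t * p t)%:E|)%E.
  case.
  - move=> n; apply/(measurable_restrictT _ (mD n)).
    exact: measurable_funS mhp.
  - exact: mhp.
  - apply: aeW => t _; apply: cvg_near_cst; near=> n.
    rewrite /F patchE mem_set// /D_ /= in_itv /= -ler_norml.
    apply: le_trans (ltW (archi_boundP (normr_ge0 t))) _.
    rewrite /a ler_nat; apply: leqW; near: n; exact: nbhs_infty_ge.
  - exact: integrable_abse ip.
  - by apply: aeW => t n _; exact: Fabs.
  - by move=> _ _. }
have FE n : (\int[mu]_t F n t = (- (s ^+ 2) * (H (a n) - H (- a n)))%:E)%E.
  rewrite /F -integral_mkcond -ftc' /Rintegral fineK//.
  apply: integrable_fin_num => //.
  by apply: integrableS ip.
suff cv0 : (\int[mu]_t F n t)%E @[n --> \oo] --> 0%E.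
  by have -> := cvg_unique _ cvF cv0.
under eq_fun do rewrite FE.
apply: cvg_EFin; first by exact: nearW.
rewrite -(mulr0 (- s ^+ 2)); apply: cvgM; first exact: cvg_cst.
apply/cvgrPdist_le => /= e e0.
near=> n; rewrite sub0r normrN; apply: le_trans (ler_normB _ _) _.
have an1 : 1 <= a n by rewrite ler1n.
have h1 : `|H (a n)| <= C * D / a n.
  by have := Hb (a n); rewrite ger0_norm ?(ltW (a0 n))//; exact.
have h2 : `|H (- a n)| <= C * D / a n.
  by have := Hb (- a n); rewrite normrN ger0_norm ?(ltW (a0 n))//; exact.
apply: le_trans (lerD h1 h2) _.
rewrite -mulrDl ler_pdivrMr// (mulrC e) -ler_pdivrMr//.
apply: le_trans (ler_norm _) _.
apply: le_trans (ltW (archi_boundP (normr_ge0 _))) _.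
rewrite /a ler_nat; apply: leqW; near: n; exact: nbhs_infty_ge.
Unshelve. all: by end_near. Qed.

End gaussian.

(** * Integration by parts for independent Gaussian variables *)

Section mean_zero_fiber.
Context {d : measure_display} {T : measurableType d} {d1 : measure_display}
  {T1 : measurableType d1} {d2 : measure_display} {T2 : measurableType d2}
  {R : realType}.

(** When X and Y are independent, Fubini reduces a centered expectation to its
fibers over Y. The variable Y takes values in an arbitrary measurable space, so
that it can be the identity onto a sub-sigma-algebra. *)
Lemma mean_zero_fiber (P : probability T R) (N : probability T1 R)
    (X : T -> T1) (Y : {mfun T >-> T2}) (f : T1 * T2 -> R) :
  measurable_fun setT X ->
  (forall A B, measurable A -> measurable B ->
    P (X @^-1` A `&` Y @^-1` B) = (N A * P (Y @^-1` B))%E) ->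
  measurable_fun setT f ->
  integrableR P (fun w => f (X w, Y w)) ->
  (forall y, mean_zero N (fun x => f (x, y))) ->
  mean_zero P (fun w => f (X w, Y w)).
Proof.
move=> mX ind mf fi f0.
pose Q : probability T2 R := distribution P Y.
pose XY w := (X w, Y w).
have mXY : measurable_fun setT XY by apply: measurable_fun_pair.
have prodE A : measurable A -> (N \x Q)%E A = pushforward P XY A.
  by apply: product_measure_unique => B C mB mC; exact: ind.
split => //.
have mfE : measurable_fun setT (EFin \o f) by exact/measurable_EFinP.
have push := integral_pushforward mXY mfE fi measurableT.
have ip := integrable_pushforward mXY mfE fi measurableT.
have ip2 : (N \x Q)%E.-integrable setT (EFin \o f).
  apply/integrableP; split => //.
  move/integrableP : ip => [_].
  rewrite (eq_measure_integral (N \x Q)%E); first exact.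
  by move=> A mA _; apply/esym; exact: prodE.
rewrite /Rintegral.
suff -> : (\int[P]_w (f (X w, Y w))%:E = 0)%E by [].
transitivity (\int[N \x Q]_z (EFin \o f) z)%E.
  rewrite (eq_measure_integral (pushforward P XY)); first exact/esym.
  by move=> A mA _; exact: prodE.
rewrite -(integral21_prod_meas1 ip2).
rewrite (eq_integral (fun=> 0%E)) ?integral0// => y _.
have [fyi fy0] := f0 y; rewrite /fubini_G /=.
rewrite -[LHS]fineK; first by move: fy0; rewrite /Rintegral /= => ->.
exact: integrable_fin_num.
Qed.

End mean_zero_fiber.

Section independence.
Context {d : measure_display} {T : measurableType d} {R : realType}.
Variables (P : probability T R) (I : finType) (X : I -> T -> R).
Hypothesis mX : forall i, measurable_fun setT (X i).
Hypothesis indX : mutually_independent P (fun i => sigma_fun (X i)).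
Variable i0 : I.

(** A pi-system that generates the sigma-algebra of the X j with j != i0. All
j != i0 occur in each intersection, which makes stability under intersection
immediate. *)
Definition others : set (set T) :=
  [set C | exists2 E : I -> set T, (forall j, sigma_fun (X j) (E j)) &
     C = \bigcap_(j in [set j | j \in [set~ i0]%SET]) E j].

Lemma sigma_fun_preimage j (B : set R) : measurable B ->
  sigma_fun (X j) (X j @^-1` B).
Proof. by move=> mB; exists B => //; rewrite setTI. Qed.

Lemma sigma_funT j : sigma_fun (X j) setT.
Proof. by rewrite -(preimage_setT (X j)); exact: sigma_fun_preimage. Qed.

Lemma sigma_fun_measurable j E : sigma_fun (X j) E -> measurable E.
Proof. by move=> [B mB <-]; exact: mX. Qed.

Lemma others_measurable : others `<=` measurable.
Proof.
move=> _ [E hE ->]; apply: fin_bigcap_measurable => [|j _].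
  exact: finite_finset.
exact: sigma_fun_measurable (hE j).
Qed.

Lemma othersT : others setT.
Proof.
exists (fun=> setT); first exact: sigma_funT.
by apply/esym; apply: bigcapT.
Qed.

Lemma othersI : setI_closed others.
Proof.
move=> _ _ [E hE ->] [F hF ->]; exists (fun j => E j `&` F j); last by rewrite bigcapI.
move=> j; have [A mA <-] := hE j; have [B mB <-] := hF j.
exists (A `&` B); first exact: measurableI.
by rewrite !setTI preimage_setI.
Qed.

Lemma others_fun (j : I) (B : set R) : j != i0 -> measurable B ->
  <<s others >> (X j @^-1` B).
Proof.
move=> ji mB; apply: sub_sigma_algebra.
exists (fun k => if k == j then X j @^-1` B else setT).
  move=> k; case: eqVneq => [->|_]; first exact: sigma_fun_preimage.
  exact: sigma_funT.
apply/seteqP; split => [w Bw k _|w].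
  by case: eqVneq.
by move=> /(_ j); rewrite eqxx; apply => /=; rewrite !inE.
Qed.

(** The two sides are finite measures in C that agree on the pi-system
[others]. *)
Lemma indep_others (B : set R) (C : set T) : measurable B -> <<s others >> C ->
  P (X i0 @^-1` B `&` C) = (P (X i0 @^-1` B) * P C)%E.
Proof.
move=> mB sC.
have mD : measurable (X i0 @^-1` B).
  by rewrite -[X in measurable X]setTI; exact: mX.
pose D := X i0 @^-1` B.
have PD0 : 0 <= fine (P D) by apply: fine_ge0.
have PDE : P D = (fine (P D))%:E by rewrite fineK// fin_num_measure.
pose m1 := mrestr P mD.
pose m2 := mscale (NngNum PD0) P.
suff : m1 C = m2 C.
  by move=> e; rewrite setIC PDE; exact: e.
apply: (@g_sigma_algebra_measure_unique _ _ _ others others_measurable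
  (fun=> setT) (fun=> othersT) _ m1 m2 othersI _ _ C sC).
- by rewrite bigcup_const//; exists 0%N.
- move=> A [E hE ->].
  set C' := \bigcap_(_ in _) _.
  suff: P (C' `&` D) = (P D * P C')%E by move=> e; apply: (etrans e); rewrite {1}PDE.
  pose E' j := if j == i0 then D else E j.
  have hE' j : sigma_fun (X j) (E' j).
    by rewrite /E'; case: eqVneq => [->|_]; [exact: sigma_fun_preimage|exact: hE].
  have := indX (J := [set: I]%SET) (E := E') (fun j _ => hE' j).
  rewrite (bigD1 i0) ?inE//= => e1.
  have := indX (J := [set~ i0]%SET) (E := E) (fun j _ => hE j).
  move=> ->.
  have E'i0 : E' i0 = D by rewrite /E' eqxx.
  rewrite E'i0 in e1.
  rewrite (eq_bigr (fun j => P (E j))) in e1; last first.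
    by move=> j /andP[_ ji]; rewrite /E' (negbTE ji).
  rewrite (eq_bigl (fun j => j \in [set~ i0]%SET)) in e1; last first.
    by move=> j; rewrite !inE.
  rewrite -e1; congr (P _); apply/seteqP; split.
    move=> w [h1 h2] j _; rewrite /E'; case: eqVneq => [//|ji].
    by apply: h1; rewrite /= !inE.
  move=> w h; split.
    move=> j /=; rewrite !inE => ji.
    by have := h j; rewrite /E' (negbTE ji); apply; rewrite /= inE.
  by have := h i0; rewrite /E' eqxx; apply; rewrite /= inE.
- move=> k; change (P (setT `&` D) < +oo)%E; rewrite setTI.
  by rewrite ltey_eq fin_num_measure.
Qed.

End independence.

Definition update (I : finType) (R : Type) (x : I -> R) (i : I) (t : R) : I -> R :=
  fun j => if j == i then t else x j.

(** Measurability of F for the product sigma-algebra, expressed by substitution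
of arbitrary measurable coordinates. *)
Definition measurable_of {R : realType} (I : finType) (F : (I -> R) -> R) : Prop :=
  forall d (T : measurableType d) (Y : I -> T -> R),
    (forall i, measurable_fun setT (Y i)) ->
    measurable_fun setT (fun w => F (Y^~ w)).

Section stein.
Context {d : measure_display} {T : measurableType d} {R : realType}.
Variables (P : probability T R) (I : finType) (X : I -> T -> R) (s : R).
Hypothesis s0 : s != 0.
Hypothesis mX : forall i, measurable_fun setT (X i).
Hypothesis indX : mutually_independent P (fun i => sigma_fun (X i)).
Hypothesis lawX : forall i (B : set R), measurable B ->
  P (X i @^-1` B) = normal_prob 0 s B.

Lemma gaussian_sqr_integrable i : integrableR P (fun w => X i w ^+ 2).
Proof.
apply/integrableP; split.
  by apply/measurable_EFinP; exact: measurable_funX.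
have /integrableP[_] := normal_integrable_sqr s0.
pose g (x : measurableTypeR R) := `|((x : R) ^+ 2)%:E|%E.
pose Xi : T -> measurableTypeR R := X i.
have e : (\int[normal_prob 0 s]_x g x = \int[pushforward P Xi]_x g x)%E.
  apply: eq_measure_integral; first exact: mX.
  by move=> mXi A mA _; apply/esym; exact: lawX.
change (\int[normal_prob 0 s]_x g x < +oo -> \int[P]_x (g \o Xi) x < +oo)%E.
rewrite e.
have mg : measurable_fun setT (fun x : R => `|(x ^+ 2)%:E|%E).
  by apply: measurableT_comp => //; apply/measurable_EFinP; exact: measurable_funX.
rewrite ge0_integral_pushforward//; first exact: mX.
by move=> x _; exact: abse_ge0.
Qed.

Definition linear_growth (F : (I -> R) -> R) : Prop :=
  exists C, forall x, `|F x| <= C * (1 + \sum_j `|x j|).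

Lemma linear_growth_ge0 F : linear_growth F ->
  exists2 C, 0 <= C & forall x, `|F x| <= C * (1 + \sum_j `|x j|).
Proof.
move=> [C hC]; exists C => //.
have := hC (fun=> 0); rewrite big1 ?addr0 ?mulr1; last by move=> j _; rewrite normr0.
exact: le_trans.
Qed.

Lemma integrable_linear_growth F : measurable_of F -> linear_growth F ->
  integrableR P (fun w => F (X^~ w)).
Proof.
move=> mF /linear_growth_ge0[C C0 hC].
apply: (integrableR_le (g := fun w => C * (1 + \sum_j (1 + X j w ^+ 2)))).
- exact: mF.
- move=> w; apply: le_trans (hC _) _; rewrite ler_wpM2l// lerD2l.
  apply: ler_sum => j _; rewrite -(real_normK (num_real (X j w))).
  by have := normr_ge0 (X j w); nra.
- apply: integrableRZ; apply: integrableRD; first exact: integrableR_cst.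
  apply: integrableR_sum => j; apply: integrableRD; first exact: integrableR_cst.
  exact: gaussian_sqr_integrable.
Qed.

Lemma integrable_mul_linear_growth i F : measurable_of F -> linear_growth F ->
  integrableR P (fun w => X i w * F (X^~ w)).
Proof.
move=> mF /linear_growth_ge0[C C0 hC].
apply: (integrableR_le
  (g := fun w => C * (1 + X i w ^+ 2 + \sum_j (X i w ^+ 2 + X j w ^+ 2)))).
- by apply: measurable_funM => //; exact: mF.
- move=> w; rewrite normrM.
  apply: (@le_trans _ _ (`|X i w| * (C * (1 + \sum_j `|X j w|)))).
    by rewrite ler_wpM2l.
  rewrite mulrCA ler_wpM2l// mulrDr mulr1 mulr_sumr; apply: lerD.
    rewrite -(real_normK (num_real (X i w))).
    by have := normr_ge0 (X i w); nra.
  apply: ler_sum => j _.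
  rewrite -(real_normK (num_real (X i w))) -(real_normK (num_real (X j w))).
  by have := normr_ge0 (X i w); have := normr_ge0 (X j w); nra.
- apply: integrableRZ; apply: integrableRD.
    apply: integrableRD; first exact: integrableR_cst.
    exact: gaussian_sqr_integrable.
  apply: integrableR_sum => j; apply: integrableRD; exact: gaussian_sqr_integrable.
Qed.

(** Conditionally on the X j with j != i, the statement is [stein_normal] for
F as a function of its i-th coordinate. The conditioning is [mean_zero_fiber]
for the pair of X i and the identity of T, seen as a map onto T with the
sigma-algebra of the X j with j != i. *)
Theorem stein i (F G : (I -> R) -> R) :
  measurable_of F -> measurable_of G -> linear_growth F -> linear_growth G ->
  (forall (x : I -> R) (t : R), is_derive t 1 (fun u => F (update x i u)) (G (update x i t))) ->
  (forall x : I -> R, continuous (fun t : R => G (update x i t))) ->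
  mean_zero P (fun w => X i w * F (X^~ w) - s ^+ 2 * G (X^~ w)).
Proof.
move=> mF mG lF lG dF cG.
pose T' := g_sigma_algebraType (others X i).
have mid : measurable_fun setT (idfun : T -> T').
  move=> _ B mB; rewrite setTI preimage_id.
  have sG := smallest_sub (@sigma_algebra_measurable _ T) (others_measurable mX (i0 := i)).
  exact: (sG B mB).
pose Y : {mfun T >-> T'} :=
  MeasurableFun.Pack (MeasurableFun.Class (isMeasurableFun.Build _ _ _ _ _ mid)).
pose upX (z : R * T') : I -> R := update (X^~ z.2) i z.1.
have upXE w : upX (X i w, Y w) = X^~ w.
  by apply/funext => j; rewrite /upX /update /=; case: eqVneq => [->|].
pose f (z : R * T') := z.1 * F (upX z) - s ^+ 2 * G (upX z).
have mup j : measurable_fun setT (fun z : R * T' => upX z j).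
  rewrite /upX /update; case: eqVneq => [_|ji]; first exact: measurable_fst.
  have mXj : measurable_fun setT (X j : T' -> R).
    by move=> _ B mB; rewrite setTI; exact: others_fun.
  exact: (measurableT_comp mXj measurable_snd).
have mf : measurable_fun setT f.
  { apply: measurable_funB; apply: measurable_funM => //.
  - exact: (mF _ _ (fun j z => upX z j)).
  - exact: (mG _ _ (fun j z => upX z j)). }
apply: (mean_zero_ext (f := fun w => f (X i w, Y w))).
  by move=> w; rewrite /f upXE.
apply: (@mean_zero_fiber _ _ _ _ _ _ _ P (normal_prob 0 s)).
- exact: mX.
- move=> A B mA mB; rewrite (indep_others mX indX)//; congr (_ * _)%E; exact: lawX.
- exact: mf.
- apply: (integrableR_ext (f := fun w => X i w * F (X^~ w) + - s ^+ 2 * G (X^~ w))).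
    by move=> w; rewrite /f upXE mulNr.
  apply: integrableRD; first exact: integrable_mul_linear_growth.
  by apply: integrableRZ; exact: integrable_linear_growth.
- move=> y; rewrite /f /upX /=.
  have [C1 C10 h1] := linear_growth_ge0 lF; have [C2 C20 h2] := linear_growth_ge0 lG.
  pose K := 1 + \sum_(j | j != i) `|X j y|.
  have K1 : 1 <= K by rewrite lerDl sumr_ge0.
  have K0 : 0 <= K by exact: le_trans K1.
  have KE t : 1 + \sum_j `|update (X^~ y) i t j| = K + `|t|.
    rewrite (bigD1 i)//= {1}/update eqxx addrCA addrC; congr (1 + _ + _).
    by apply: eq_bigr => j ji; rewrite /update (negbTE ji).
  apply: (@stein_normal _ s s0 (fun t => F (update (X^~ y) i t))
    (fun t => G (update (X^~ y) i t)) ((C1 + C2) * K)).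
  + exact: cG.
  + move=> t; apply: le_trans (h1 _) _; rewrite KE -mulrA.
    apply: ler_pM => //; [exact: addr_ge0|by rewrite lerDl|].
    by have := normr_ge0 t; nra.
  + move=> t; apply: le_trans (h2 _) _; rewrite KE -mulrA.
    apply: ler_pM => //; [exact: addr_ge0|by rewrite lerDr|].
    by have := normr_ge0 t; nra.
Qed.

End stein.

(** * Regularized least squares *)

Section dot.
Context {R : realType}.

Lemma cauchy_schwarz_sum (I : finType) (a b : I -> R) :
  (\sum_i a i * b i) ^+ 2 <= (\sum_i a i ^+ 2) * (\sum_i b i ^+ 2).
Proof.
have : 0 <= \sum_i \sum_j (a i * b j - a j * b i) ^+ 2.
  by apply: sumr_ge0 => i _; apply: sumr_ge0 => j _; exact: sqr_ge0.
have -> : \sum_i \sum_j (a i * b j - a j * b i) ^+ 2 =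
   2 * ((\sum_i a i ^+ 2) * (\sum_i b i ^+ 2) - (\sum_i a i * b i) ^+ 2).
  rewrite expr2 !big_distrlr /= -sumrB mulr_sumr.
  transitivity (\sum_i \sum_j (a i ^+ 2 * b j ^+ 2 - a i * b i * (a j * b j)) +
    \sum_i \sum_j (a i ^+ 2 * b j ^+ 2 - a i * b i * (a j * b j))).
    rewrite [in X in _ + X]exchange_big -big_split; apply: eq_bigr => i _.
    by rewrite -big_split; apply: eq_bigr => j _ /=; ring.
  rewrite -big_split; apply: eq_bigr => i _ /=.
  by rewrite mulr_natl mulr2n sumrB.
by rewrite pmulr_rge0// subr_ge0.
Qed.

Definition dotv (p : nat) (x y : 'cV[R]_p) : R := \sum_i x i ord0 * y i ord0.

Lemma dotvE p (x y : 'cV[R]_p) : dotv x y = (x^T *m y) ord0 ord0.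
Proof. by rewrite mxE; apply: eq_bigr => i _; rewrite mxE. Qed.

Lemma sqnorm2E p (x : 'cV[R]_p) : sqnorm2 x = dotv x x.
Proof. by apply: eq_bigr => i _; rewrite expr2. Qed.

Lemma dotvC p (x y : 'cV[R]_p) : dotv x y = dotv y x.
Proof. by apply: eq_bigr => i _; rewrite mulrC. Qed.

Lemma dotvDl p (x y z : 'cV[R]_p) : dotv (x + y) z = dotv x z + dotv y z.
Proof. by rewrite -big_split; apply: eq_bigr => i _; rewrite mxE mulrDl. Qed.

Lemma dotvZl p c (x z : 'cV[R]_p) : dotv (c *: x) z = c * dotv x z.
Proof. by rewrite mulr_sumr; apply: eq_bigr => i _; rewrite mxE mulrA. Qed.

Lemma dotvDr p (x y z : 'cV[R]_p) : dotv z (x + y) = dotv z x + dotv z y.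
Proof. by rewrite !(dotvC z) dotvDl. Qed.

Lemma dotvZr p c (x z : 'cV[R]_p) : dotv z (c *: x) = c * dotv z x.
Proof. by rewrite !(dotvC z) dotvZl. Qed.

Lemma dotvNl p (x z : 'cV[R]_p) : dotv (- x) z = - dotv x z.
Proof. by rewrite -scaleN1r dotvZl mulN1r. Qed.

Lemma dotvNr p (x z : 'cV[R]_p) : dotv z (- x) = - dotv z x.
Proof. by rewrite !(dotvC z) dotvNl. Qed.

Lemma dotv_mulr p k (x : 'cV[R]_p) (M : 'M[R]_(p, k)) (y : 'cV[R]_k) :
  dotv x (M *m y) = dotv (M^T *m x) y.
Proof. by rewrite !dotvE trmx_mul trmxK mulmxA. Qed.

Lemma dotv_mull p k (x : 'cV[R]_p) (M : 'M[R]_(p, k)) (y : 'cV[R]_k) :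
  dotv (M *m y) x = dotv y (M^T *m x).
Proof. by rewrite dotvC dotv_mulr dotvC. Qed.

Lemma sqnorm2_ge0 p (x : 'cV[R]_p) : 0 <= sqnorm2 x.
Proof. by apply: sumr_ge0 => i _; exact: sqr_ge0. Qed.

Lemma sqnorm2_eq0 p (x : 'cV[R]_p) : sqnorm2 x = 0 -> x = 0.
Proof.
move/eqP; rewrite psumr_eq0 => [/allP h|i _]; last exact: sqr_ge0.
apply/matrixP => i j; rewrite ord1 mxE.
by have := h i; rewrite mem_index_enum /= sqrf_eq0 => /(_ isT)/eqP.
Qed.

Lemma sqnorm2D p (x y : 'cV[R]_p) :
  sqnorm2 (x + y) = sqnorm2 x + 2 * dotv x y + sqnorm2 y.
Proof. by rewrite !sqnorm2E !(dotvDl, dotvDr) (dotvC y x); ring. Qed.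

Lemma sqnorm2B p (x y : 'cV[R]_p) :
  sqnorm2 (x - y) = sqnorm2 x - 2 * dotv x y + sqnorm2 y.
Proof. by rewrite !sqnorm2E !(dotvDl, dotvDr, dotvNl, dotvNr) (dotvC y x); ring. Qed.

Lemma sqnorm2Z p c (x : 'cV[R]_p) : sqnorm2 (c *: x) = c ^+ 2 * sqnorm2 x.
Proof. by rewrite !sqnorm2E dotvZl dotvZr; ring. Qed.

Lemma dotv_le p (x y : 'cV[R]_p) : `|dotv x y| <= (sqnorm2 x + sqnorm2 y) / 2.
Proof.
rewrite ler_norml; have := sqnorm2_ge0 (x + y); have := sqnorm2_ge0 (x - y).
rewrite sqnorm2B sqnorm2D; lra.
Qed.

Lemma sqr_entry_le p (x : 'cV[R]_p) i : x i ord0 ^+ 2 <= sqnorm2 x.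
Proof.
rewrite /sqnorm2 (bigD1 i)//= lerDl; apply: sumr_ge0 => j _; exact: sqr_ge0.
Qed.

Lemma norm_entry_le p (x : 'cV[R]_p) i C :
  sqnorm2 x <= C -> `|x i ord0| <= 1 + C.
Proof.
move=> xC; have := le_trans (sqr_entry_le x i) xC.
rewrite -(real_normK (num_real (x i ord0))).
have := normr_ge0 (x i ord0); set a := `|_|; nra.
Qed.

(** The squared Frobenius norm. *)
Definition frob2 (p k : nat) (M : 'M[R]_(p, k)) : R := \sum_i \sum_j M i j ^+ 2.

Lemma frob2_ge0 p k (M : 'M[R]_(p, k)) : 0 <= frob2 M.
Proof. by apply: sumr_ge0 => i _; apply: sumr_ge0 => j _; exact: sqr_ge0. Qed.

Lemma frob2_tr p k (M : 'M[R]_(p, k)) : frob2 M^T = frob2 M.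
Proof.
rewrite /frob2 exchange_big; apply: eq_bigr => i _; apply: eq_bigr => j _.
by rewrite mxE.
Qed.

Lemma sqnorm2_mulmx_le p k (M : 'M[R]_(p, k)) (x : 'cV_k) :
  sqnorm2 (M *m x) <= frob2 M * sqnorm2 x.
Proof.
rewrite /sqnorm2 /frob2 mulr_suml; apply: ler_sum => i _.
rewrite mxE; exact: (cauchy_schwarz_sum (M i) (fun j => x j ord0)).
Qed.

Lemma unitmx_inj (n : nat) (M : 'M[R]_n) :
  (forall u : 'cV_n, M *m u = 0 -> u = 0) -> M \in unitmx.
Proof.
move=> h; rewrite -unitmx_tr -row_free_unit -kermx_eq0; apply/eqP/row_matrixP => i.
rewrite row0; apply: trmx_inj; rewrite trmx0; apply: h.
apply: trmx_inj; rewrite trmx_mul trmxK trmx0.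
by apply/sub_kermxP; exact: row_sub.
Qed.

End dot.

Lemma mulmx_delta (R : realType) p k (M : 'M[R]_(p, k)) (j : 'I_k) i :
  (M *m (delta_mx j ord0 : 'cV_k)) i ord0 = M i j.
Proof. by have := esym (colE j M) => ->; rewrite mxE. Qed.

Section regularized.
Context {R : realType} {n m : nat}.
Implicit Types (B : 'M[R]_(n, m)) (e : R).

(** For B B^T + e with e > 0, the regularized inverse N and pseudo-inverse
Z = B^T N. *)
Definition reg_gram e B : 'M[R]_n := B *m B^T + e%:M.
Definition reg_inv e B : 'M[R]_n := invmx (reg_gram e B).
Definition reg_pinv e B : 'M[R]_(m, n) := B^T *m reg_inv e B.

Lemma reg_gram_tr e B : (reg_gram e B)^T = reg_gram e B.
Proof. by rewrite /reg_gram linearD /= trmx_mul trmxK tr_scalar_mx. Qed.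

Lemma dotv_gram B (u : 'cV_n) : dotv u (B *m B^T *m u) = sqnorm2 (B^T *m u).
Proof. by rewrite -mulmxA dotv_mulr sqnorm2E. Qed.

Lemma dotv_reg_gram e B (u : 'cV_n) :
  dotv u (reg_gram e B *m u) = sqnorm2 (B^T *m u) + e * sqnorm2 u.
Proof.
by rewrite mulmxDl dotvDr dotv_gram mul_scalar_mx dotvZr sqnorm2E.
Qed.

Lemma gram_unit B : \rank B = n -> B *m B^T \in unitmx.
Proof.
move=> rB; apply: unitmx_inj => u Wu.
have : sqnorm2 (B^T *m u) = 0 by rewrite -dotv_gram Wu dotvE mulmx0 mxE.
move/sqnorm2_eq0/(congr1 trmx); rewrite trmx_mul trmxK trmx0 => uB.
have rf : row_free B by rewrite /row_free rB.
apply: trmx_inj; rewrite trmx0; apply: (row_free_inj rf).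
by rewrite uB mul0mx.
Qed.

Section positive.
Variables (e : R) (B : 'M[R]_(n, m)).
Hypothesis e0 : 0 < e.
Local Notation N := (reg_inv e B).
Local Notation Z := (reg_pinv e B).

Lemma reg_gram_unit : reg_gram e B \in unitmx.
Proof.
apply: unitmx_inj => u Wu.
have := dotv_reg_gram e B u; rewrite Wu dotvE mulmx0 mxE => /esym h.
apply: sqnorm2_eq0; have := sqnorm2_ge0 u; have := sqnorm2_ge0 (B^T *m u) => h1 h2.
have : e * sqnorm2 u <= 0 by lra.
by rewrite pmulr_rle0// => h3; apply/eqP; rewrite eq_le h3.
Qed.

Lemma reg_inv_tr : N^T = N.
Proof. by rewrite /reg_inv trmx_inv reg_gram_tr. Qed.

Lemma reg_pinv_tr : Z^T = N *m B.
Proof. by rewrite /reg_pinv trmx_mul trmxK reg_inv_tr. Qed.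

Lemma gram_reg_inv : B *m B^T *m N = 1%:M - e *: N.
Proof.
have := mulmxV reg_gram_unit; rewrite -/N mulmxDl mul_scalar_mx => <-.
by rewrite addrK.
Qed.

Lemma reg_inv_gram : N *m (B *m B^T) = 1%:M - e *: N.
Proof.
have := mulVmx reg_gram_unit; rewrite -/N mulmxDr mul_mx_scalar => <-.
by rewrite addrK.
Qed.

Lemma mul_reg_pinv : B *m Z = 1%:M - e *: N.
Proof. by rewrite mulmxA gram_reg_inv. Qed.

(** Source of all the bounds below: both terms on the right are nonnegative. *)
Lemma dotv_reg_inv (u : 'cV_n) :
  dotv u (N *m u) = sqnorm2 (Z *m u) + e * sqnorm2 (N *m u).
Proof.
rewrite -mulmxA -dotv_reg_gram mulmxA (mulmxV reg_gram_unit) mul1mx.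
by rewrite dotvC.
Qed.

(** Expand 0 <= |u - e N u|^2. *)
Lemma reg_inv_quad_le (u : 'cV_n) : e * dotv u (N *m u) <= sqnorm2 u.
Proof.
have := sqnorm2_ge0 (u - e *: (N *m u)).
rewrite sqnorm2B dotvZr sqnorm2Z.
have := dotv_reg_inv u; have := sqnorm2_ge0 (Z *m u); set q := dotv _ _.
set a := sqnorm2 (Z *m u); set b := sqnorm2 (N *m u); set c := sqnorm2 u.
move=> a0 qE; have : e * q = e * a + e ^+ 2 * b by rewrite qE; ring.
have := mulr_ge0 (ltW e0) a0; nra.
Qed.

Lemma reg_inv_quad_ge0 (u : 'cV_n) : 0 <= dotv u (N *m u).
Proof. by rewrite dotv_reg_inv addr_ge0 ?mulr_ge0 ?sqnorm2_ge0 ?(ltW e0). Qed.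

Lemma sqnorm2_reg_inv_le (u : 'cV_n) : e ^+ 2 * sqnorm2 (N *m u) <= sqnorm2 u.
Proof.
apply: le_trans (reg_inv_quad_le u); rewrite dotv_reg_inv mulrDr mulrA -expr2.
by rewrite lerDr mulr_ge0 ?sqnorm2_ge0 ?(ltW e0).
Qed.

Lemma sqnorm2_reg_pinv_le (u : 'cV_n) : sqnorm2 (Z *m u) <= dotv u (N *m u).
Proof. by rewrite dotv_reg_inv lerDl mulr_ge0 ?sqnorm2_ge0 ?(ltW e0). Qed.

(** Z B = B^T N B is symmetric with spectrum in [0, 1]. *)
Lemma sqnorm2_reg_proj_le (v : 'cV_m) : sqnorm2 (Z *m B *m v) <= sqnorm2 v.
Proof.
have h : sqnorm2 (Z *m B *m v) <= dotv v (Z *m B *m v).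
  rewrite -mulmxA; apply: le_trans (sqnorm2_reg_pinv_le _) _.
  by rewrite /reg_pinv -!mulmxA [leRHS]dotv_mulr trmxK.
have := sqnorm2_ge0 (v - Z *m B *m v); rewrite sqnorm2B.
by move: h; set a := sqnorm2 (_ *m v); set b := dotv _ _; lra.
Qed.

Lemma reg_inv_bound i j : `|N i j| <= 1 + e ^- 2.
Proof.
have h := sqnorm2_reg_inv_le (delta_mx j ord0).
rewrite -(mulmx_delta N j i); apply: norm_entry_le; rewrite -[e ^- 2]mul1r ler_pdivlMr ?exprn_gt0// mulrC.
apply: (le_trans h); rewrite /sqnorm2 (bigD1 j)//= big1 ?mxE ?eqxx ?expr1n ?addr0//.
by move=> k kj; rewrite mxE (negbTE kj) expr0n.
Qed.

Lemma sqnorm2_delta p (j : 'I_p) : sqnorm2 (delta_mx j ord0 : 'cV[R]_p) = 1.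
Proof.
rewrite /sqnorm2 (bigD1 j)//= big1 ?mxE ?eqxx ?expr1n ?addr0//.
by move=> k kj; rewrite mxE (negbTE kj) expr0n.
Qed.

Lemma reg_pinv_bound i j : `|Z i j| <= 1 + e^-1.
Proof.
rewrite -(mulmx_delta Z j i).
apply: norm_entry_le; apply: le_trans (sqnorm2_reg_pinv_le _) _.
rewrite -[e^-1]mul1r ler_pdivlMr// mulrC.
by apply: le_trans (reg_inv_quad_le _) _; rewrite sqnorm2_delta.
Qed.

Lemma reg_proj_bound i j : `|(Z *m B) i j| <= 2.
Proof.
rewrite -(mulmx_delta (Z *m B) j i).
have := norm_entry_le i (sqnorm2_reg_proj_le (delta_mx j ord0)).
by rewrite sqnorm2_delta -natr1 addrC.
Qed.

Lemma tr_reg_inv_ge0 : 0 <= \tr N.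
Proof.
rewrite /mxtrace; apply: sumr_ge0 => i _.
have := reg_inv_quad_ge0 (delta_mx i ord0).
rewrite /dotv (bigD1 i)//= big1 ?addr0; last first.
  by move=> k ki; rewrite mxE (negbTE ki) mul0r.
by rewrite mxE !eqxx mul1r mulmx_delta.
Qed.

Lemma quad_delta i : dotv (delta_mx i ord0) (N *m delta_mx i ord0) = N i i.
Proof.
rewrite /dotv (bigD1 i)//= big1 ?addr0; last first.
  by move=> k ki; rewrite mxE (negbTE ki) mul0r.
by rewrite mxE !eqxx mul1r mulmx_delta.
Qed.

Lemma tr_reg_inv_le : e * \tr N <= n%:R.
Proof.
rewrite /mxtrace mulr_sumr -[n in leRHS]card_ord -sumr_const; apply: ler_sum => i _.
by rewrite -quad_delta; apply: le_trans (reg_inv_quad_le _) _; rewrite sqnorm2_delta.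
Qed.

Lemma frob2_reg_inv_le : e * frob2 N <= \tr N.
Proof.
rewrite -frob2_tr /frob2 mulr_sumr; apply: ler_sum => i _.
rewrite -quad_delta dotv_reg_inv; apply: le_trans (_ : e * sqnorm2 (N *m delta_mx i ord0) <= _); last first.
  by rewrite lerDr sqnorm2_ge0.
rewrite /sqnorm2 ler_wpM2l// ?(ltW e0)//; apply: ler_sum => j _.
by rewrite mulmx_delta mxE.
Qed.

(** A unit vector v in the kernel of B B^T satisfies N v = v / e, and
|N v|^2 <= |N|_F^2 <= tr N / e. *)
Lemma tr_reg_inv_singular : B *m B^T \notin unitmx -> 1 <= e * \tr N.
Proof.
move=> sing; have [v [Wv v0]] : exists v : 'cV_n, B *m B^T *m v = 0 /\ v != 0.
  apply: contrapT => h; move/negP: sing; apply; apply: unitmx_inj => u Wu.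
  by apply: contrapT => /eqP u0; apply: h; exists u.
have Nv : e *: (N *m v) = v.
  have := mulVmx reg_gram_unit => /(congr1 (mulmx^~ v)).
  by rewrite mul1mx -mulmxA mulmxDl Wv add0r mul_scalar_mx -scalemxAr.
have v1 : 0 < sqnorm2 v.
  rewrite lt_neqAle sqnorm2_ge0 andbT eq_sym; apply: contra v0 => /eqP/sqnorm2_eq0 ->.
  exact: eqxx.
have h1 := sqnorm2_mulmx_le N v.
have h2 : sqnorm2 v = e ^+ 2 * sqnorm2 (N *m v) by rewrite -sqnorm2Z Nv.
have h3 : e ^+ 2 * sqnorm2 (N *m v) <= e * \tr N * sqnorm2 v.
  apply: (@le_trans _ _ (e ^+ 2 * (frob2 N * sqnorm2 v))).
    by rewrite ler_wpM2l ?sqr_ge0.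
  rewrite expr2 -!mulrA ler_wpM2l ?(ltW e0)// mulrA ler_wpM2r ?sqnorm2_ge0//.
  exact: frob2_reg_inv_le.
by move: h3; rewrite -h2 -[leLHS]mul1r ler_pM2r.
Qed.

Lemma reg_inv_solvable (u : 'cV_n) :
  N *m (B *m B^T *m u) = u - e *: (N *m u).
Proof. by rewrite mulmxA reg_inv_gram mulmxBl mul1mx -scalemxAl. Qed.

Lemma reg_pinv_solvable (u : 'cV_n) :
  Z *m (B *m B^T *m u) = B^T *m u - e *: (Z *m u).
Proof. by rewrite -[LHS]mulmxA reg_inv_solvable mulmxBr -scalemxAr mulmxA. Qed.

(** On b = B B^T u the quadratic form b^T N b is within e |u|^2 of the squared
norm of the minimum-norm solution B^T u. *)
Lemma reg_quad_eq (u : 'cV_n) :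
  dotv (B *m B^T *m u) (N *m (B *m B^T *m u)) =
  sqnorm2 (B^T *m u) - e * (sqnorm2 u - e * dotv u (N *m u)).
Proof.
rewrite reg_inv_solvable dotvDr dotvNr dotvC dotv_gram dotvZr.
rewrite dotv_mull trmx_mul trmxK mulmxA -[B *m B^T *m N]mulmxA.
by rewrite -/(reg_pinv e B) mul_reg_pinv mulmxBl mul1mx dotvDr dotvNr -scalemxAl dotvZr -sqnorm2E.
Qed.

Lemma reg_quad_solvable (u : 'cV_n) :
  dotv (B *m B^T *m u) (N *m (B *m B^T *m u)) <= sqnorm2 (B^T *m u).
Proof.
rewrite reg_quad_eq.
have := reg_inv_quad_le u; set q := dotv _ _; set c := sqnorm2 u => h.
by rewrite lerBlDr lerDl mulr_ge0 ?(ltW e0)// subr_ge0.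
Qed.

End positive.
End regularized.

(** * Minimum-norm solutions as limits *)

Section min_norm.
Context {R : realType} {n m : nat}.
Implicit Types (B : 'M[R]_(n, m)) (b : 'cV[R]_n) (u : 'cV[R]_n).

(** B^T u is orthogonal to the kernel of B. *)
Lemma min_norm_sol_gram B u : min_norm_sol B (B *m B^T *m u) = B^T *m u.
Proof.
apply: xget_unique => [|y [/= By ymin]].
  split; first by rewrite /= mulmxA.
  move=> y /= By.
  have -> : y = B^T *m u + (y - B^T *m u) by rewrite addrC subrK.
  rewrite sqnorm2D dotv_mull trmxK mulmxBr By mulmxA subrr.
  by rewrite dotvE mulmx0 mxE mulr0 addr0 lerDl sqnorm2_ge0.
have := ymin (B^T *m u); rewrite mulmxA => /(_ erefl).
have yE : y = B^T *m u + (y - B^T *m u) by rewrite addrC subrK.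
rewrite {1}yE sqnorm2D dotv_mull trmxK mulmxBr By mulmxA subrr.
rewrite dotvE mulmx0 mxE mulr0 addr0 gerDl => h.
apply/eqP; rewrite -subr_eq0; apply/eqP; apply: sqnorm2_eq0; apply/eqP.
by rewrite eq_le h sqnorm2_ge0.
Qed.

Lemma min_norm_sol_unsolvable B b :
  (forall y, B *m y <> b) -> min_norm_sol B b = 0.
Proof. by move=> h; apply: xgetPN => y [/= /h]. Qed.

(** B B^T and B have the same range, because x B B^T = 0 forces
|x B|^2 = 0. *)
Lemma solvable_gram B b : (exists y, B *m y = b) -> exists u, B *m B^T *m u = b.
Proof.
move=> [y By].
have rk : \rank (B *m B^T) = \rank B.
  have := mxrank_mul_ker B B^T.
  have -> : (B :&: kermx B^T)%MS = 0.
    apply/eqP/rowV0P => v; rewrite sub_capmx => /andP[/submxP[x ->]] /sub_kermxP h.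
    apply: trmx_inj; rewrite trmx0; apply: sqnorm2_eq0.
    by rewrite sqnorm2E dotvE trmxK trmx_mul mulmxA h mul0mx mxE.
  by rewrite mxrank0 addn0.
have sub : (B^T <= B *m B^T)%MS.
  by rewrite -(geq_leqif (mxrank_leqif_sup (submxMl B B^T))) rk mxrank_tr.
have : (b^T <= B *m B^T)%MS.
  by rewrite -By trmx_mul; apply: submx_trans sub; exact: submxMl.
move=> /submxP[x hx]; exists x^T.
by apply: trmx_inj; rewrite !trmx_mul !trmxK hx.
Qed.

Definition eps_ (k : nat) : R := k.+1%:R^-1.

Lemma eps_gt0 k : 0 < eps_ k.
Proof. by rewrite invr_gt0 ltr0n. Qed.

Lemma cvg_eps : eps_ @ \oo --> 0.
Proof. exact: cvg_harmonic. Qed.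

Lemma cvg_sandwich_eps (f : nat -> R) (l C : R) :
  (forall k, `|f k - l| <= C * eps_ k) -> f @ \oo --> l.
Proof.
move=> h; apply/subr_cvg0; apply: norm_cvg0.
apply: (squeeze_cvgr (f := fun=> 0) (h := fun k => C * eps_ k)).
- by apply: nearW => k; rewrite normr_ge0 h.
- exact: cvg_cst.
- by rewrite -[X in _ --> X](mulr0 C); apply: cvgM; [exact: cvg_cst|exact: cvg_eps].
Qed.

Lemma cvg_sandwich_sqr_eps (f : nat -> R) (l C : R) :
  (forall k, (f k - l) ^+ 2 <= C * eps_ k) -> f @ \oo --> l.
Proof.
move=> h; apply/subr_cvg0.
have h2 : (fun k => (f k - l) ^+ 2) @ \oo --> 0.
  apply: (cvg_sandwich_eps (C := C)) => k.
  by rewrite subr0 ger0_norm ?sqr_ge0.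
apply: norm_cvg0.
rewrite (_ : (fun k => `|f k - l|) = (fun k => Num.sqrt ((f k - l) ^+ 2))); last first.
  by apply/funext => k; rewrite sqrtr_sqr.
rewrite -sqrtr0; apply: continuous_cvg => //.
exact: sqrt_continuous.
Qed.

(** By [reg_pinv_solvable] the error is e Z u, and |Z u|^2 <= |u|^2 / e. *)
Lemma reg_pinv_cvg B u i :
  (fun k => (reg_pinv (eps_ k) B *m (B *m B^T *m u)) i ord0) @ \oo -->
    (B^T *m u) i ord0.
Proof.
apply: (cvg_sandwich_sqr_eps (C := sqnorm2 u)) => k.
rewrite (reg_pinv_solvable _ (eps_gt0 k)).
set Z := reg_pinv _ _; have ek := eps_gt0 k.
have -> : (B^T *m u - eps_ k *: (Z *m u)) i ord0 - (B^T *m u) i ord0 =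
   (- (eps_ k *: (Z *m u))) i ord0 by rewrite !mxE; ring.
apply: le_trans (sqr_entry_le _ _) _.
rewrite -scaleNr sqnorm2Z sqrrN expr2 -mulrA (mulrC (sqnorm2 u)) ler_wpM2l ?(ltW ek)//.
apply: le_trans (reg_inv_quad_le B ek u); rewrite ler_wpM2l ?(ltW ek)//.
exact: sqnorm2_reg_pinv_le.
Qed.

Lemma reg_inv_cvg0 B u i :
  (fun k => (eps_ k *: (reg_inv (eps_ k) B *m (B *m B^T *m u))) i ord0) @ \oo --> 0.
Proof.
apply: (cvg_sandwich_eps (C := 2 * (1 + sqnorm2 u))) => k.
have ek := eps_gt0 k; rewrite subr0 (reg_inv_solvable _ ek) mxE normrM.
rewrite (ger0_norm (ltW ek)) mulrC ler_wpM2r ?(ltW ek)// mxE.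
apply: le_trans (ler_normD _ _) _.
have -> : 2 * (1 + sqnorm2 u) = (1 + sqnorm2 u) + (1 + sqnorm2 u) by ring.
apply: lerD; first exact: norm_entry_le.
rewrite mxE normrN; apply: norm_entry_le.
by rewrite sqnorm2Z; exact: sqnorm2_reg_inv_le.
Qed.

Lemma reg_quad_cvg B u :
  (fun k => dotv (B *m B^T *m u) (reg_inv (eps_ k) B *m (B *m B^T *m u)))
    @ \oo --> sqnorm2 (B^T *m u).
Proof.
apply: (cvg_sandwich_eps (C := sqnorm2 u)) => k.
have ek := eps_gt0 k; rewrite (reg_quad_eq _ ek).
set q := dotv _ _; set c := sqnorm2 u.
have h1 : eps_ k * q <= c by exact: reg_inv_quad_le.
have h2 : 0 <= q by exact: reg_inv_quad_ge0.
have h3 : 0 <= eps_ k * q by rewrite mulr_ge0 ?(ltW ek).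
rewrite addrAC subrr add0r normrN normrM ger0_norm ?(ltW ek)// mulrC.
rewrite ler_wpM2r ?(ltW ek)// ger0_norm; lra.
Qed.

(** A criterion for solvability that is visibly measurable in B. If b is not in
the range of B, some v in the kernel of B B^T has b^T v != 0, and
(b^T v)^2 = e^2 <N b, v>^2 <= e |v|^2 (b^T N b) makes b^T N b unbounded. *)
Lemma solvableP B b : (exists y, B *m y = b) <->
  exists M : nat, forall k, dotv b (reg_inv (eps_ k) B *m b) <= M%:R.
Proof.
split => [/solvable_gram[u <-]|[M hM]].
  exists (Num.bound (sqnorm2 (B^T *m u))) => k.
  apply: le_trans (reg_quad_solvable _ (eps_gt0 k) _) _.
  by apply/ltW/archi_boundP; exact: sqnorm2_ge0.
apply: contrapT => h.
have : ~~ (b^T <= B *m B^T)%MS.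
  apply/negP => /submxP[x hx]; apply: h; exists (B^T *m x^T).
  by rewrite mulmxA; apply: trmx_inj; rewrite !trmx_mul !trmxK hx.
rewrite submxE; set K := cokermx _ => bK.
have [j hj] : exists j, (b^T *m K) ord0 j != 0.
  apply: contrapT => hn; move/negP: bK; apply; apply/eqP/matrixP => i j.
  rewrite ord1 [RHS]mxE; apply: contrapT => /eqP hij; apply: hn; exists j.
  exact: hij.
pose v := col j K.
have Wv : B *m B^T *m v = 0.
  rewrite /v colE mulmxA mulmx_coker mul0mx//.
have bv : dotv b v != 0.
  suff -> : dotv b v = (b^T *m K) ord0 j by [].
  by rewrite /dotv mxE; apply: eq_bigr => i _; rewrite !mxE.
have bound k : dotv b v ^+ 2 <= eps_ k * (M%:R * sqnorm2 v).
  have ek := eps_gt0 k.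
  have e1 : dotv b v = eps_ k * dotv (reg_inv (eps_ k) B *m b) v.
    have : reg_gram (eps_ k) B *m (reg_inv (eps_ k) B *m b) = b.
      by rewrite mulmxA (mulmxV (reg_gram_unit _ ek)) mul1mx.
    move=> {1}<-; rewrite dotv_mull reg_gram_tr.
    by rewrite mulmxDl Wv add0r mul_scalar_mx dotvZr.
  rewrite e1 exprMn.
  have cs := cauchy_schwarz_sum (fun i => (reg_inv (eps_ k) B *m b) i ord0)
    (fun i => v i ord0).
  apply: (@le_trans _ _ (eps_ k ^+ 2 * (sqnorm2 (reg_inv (eps_ k) B *m b) * sqnorm2 v))).
    by rewrite ler_wpM2l ?sqr_ge0.
  rewrite expr2 -mulrA ler_wpM2l ?(ltW ek)// mulrA ler_wpM2r ?sqnorm2_ge0//.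
  apply: le_trans (hM k); rewrite (dotv_reg_inv _ ek).
  by rewrite lerDr sqnorm2_ge0.
have : dotv b v ^+ 2 <= 0.
  have cv : (fun k => eps_ k * (M%:R * sqnorm2 v)) @ \oo --> 0.
    by rewrite -[X in _ --> X](mul0r (M%:R * sqnorm2 v)); apply: cvgM;
      [exact: cvg_eps|exact: cvg_cst].
  rewrite -(cvg_lim _ cv)//; apply: limr_ge; last exact: nearW.
  by apply/cvg_ex; exists 0.
by rewrite leNgt exprn_even_gt0//= bv.
Qed.

End min_norm.

(** * Differentiation of matrix-valued functions *)

Section matrix_derivative.
Context {R : realType}.

Lemma is_derive_big_sum (I : finType) (h : I -> R -> R) (dh : I -> R) (t : R) :
  (forall i, is_derive t 1 (h i) (dh i)) ->
  is_derive t 1 (fun s => \sum_i h i s) (\sum_i dh i).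
Proof.
move=> H; elim: (index_enum I) => [|i s IH].
  rewrite big_nil (_ : (fun _ => _) = cst 0); first exact: is_derive_cst.
  by apply/funext => s; rewrite big_nil.
rewrite big_cons (_ : (fun _ => _) = h i \+ (fun u => \sum_(j <- s) h j u)).
  by have := H i => Hi; exact: is_deriveD.
by apply/funext => u; rewrite big_cons.
Qed.

Lemma is_derive_mul (f g : R -> R) (t df dg : R) :
  is_derive t 1 f df -> is_derive t 1 g dg ->
  is_derive t 1 (fun s => f s * g s) (df * g t + f t * dg).
Proof.
move=> Hf Hg; have := is_deriveM Hf Hg.
by rewrite /GRing.scale /= addrC (mulrC (g t)).
Qed.

Definition mx_derive (p k : nat) (M : R -> 'M[R]_(p, k)) (t : R) (M' : 'M[R]_(p, k)) :=
  forall i j, is_derive t 1 (fun s => M s i j) (M' i j).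

Lemma mx_derive_cst p k (M : 'M[R]_(p, k)) t : mx_derive (fun=> M) t 0.
Proof. by move=> i j; rewrite mxE; exact: is_derive_cst. Qed.

Lemma mx_deriveD p k (M K : R -> 'M[R]_(p, k)) t M' K' :
  mx_derive M t M' -> mx_derive K t K' ->
  mx_derive (fun s => M s + K s) t (M' + K').
Proof.
move=> HM HK i j; rewrite mxE (_ : (fun _ => _) = (fun s => M s i j) \+ (fun s => K s i j)).
  by have := HM i j; have := HK i j => *; exact: is_deriveD.
by apply/funext => s; rewrite mxE.
Qed.

Lemma mx_derive_tr p k (M : R -> 'M[R]_(p, k)) t M' :
  mx_derive M t M' -> mx_derive (fun s => (M s)^T) t M'^T.
Proof.
move=> HM i j; rewrite mxE (_ : (fun _ => _) = (fun s => M s j i)); first exact: HM.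
by apply/funext => s; rewrite mxE.
Qed.

Lemma mx_derive_mul p k l (M : R -> 'M[R]_(p, k)) (K : R -> 'M[R]_(k, l)) t M' K' :
  mx_derive M t M' -> mx_derive K t K' ->
  mx_derive (fun s => M s *m K s) t (M' *m K t + M t *m K').
Proof.
move=> HM HK i j.
rewrite !mxE -big_split /= (_ : (fun _ => _) = (fun s => \sum_a M s i a * K s a j)).
  by apply: is_derive_big_sum => a; exact: is_derive_mul.
by apply/funext => s; rewrite mxE.
Qed.

Lemma mx_derive_uniq p k (M : R -> 'M[R]_(p, k)) t M1 M2 :
  mx_derive M t M1 -> mx_derive M t M2 -> M1 = M2.
Proof.
move=> H1 H2; apply/matrixP => i j.
by rewrite -(@derive_val _ _ _ _ _ _ _ (H1 i j)) (@derive_val _ _ _ _ _ _ _ (H2 i j)).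
Qed.

Lemma derivable_big_sum (I : finType) (h : I -> R -> R) (t : R) :
  (forall i, derivable (h i) t 1) -> derivable (fun s => \sum_i h i s) t 1.
Proof.
move=> H; have : is_derive t 1 (fun s => \sum_i h i s) (\sum_i 'D_1 (h i) t).
  by apply: is_derive_big_sum => i; apply: derivableP.
by case.
Qed.

Lemma derivable_big_prod (I : finType) (h : I -> R -> R) (t : R) :
  (forall i, derivable (h i) t 1) -> derivable (fun s => \prod_i h i s) t 1.
Proof.
move=> H; elim: (index_enum I) => [|i s IH].
  rewrite (_ : (fun _ => _) = cst 1); first exact: derivable_cst.
  by apply/funext => s; rewrite big_nil.
rewrite (_ : (fun _ => _) = h i * (fun u => \prod_(j <- s) h j u)).
  exact: derivableM.
by apply/funext => u; rewrite big_cons.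
Qed.

Lemma derivable_det p (M : R -> 'M[R]_p) (t : R) :
  (forall i j, derivable (fun s => M s i j) t 1) ->
  derivable (fun s => \det (M s)) t 1.
Proof.
move=> H; rewrite /determinant; apply: derivable_big_sum => sg.
apply: (@derivableM _ _ (cst _)); first exact: derivable_cst.
by apply: derivable_big_prod.
Qed.

(** Cramer's formula. *)
Lemma derivable_invmx p (M : R -> 'M[R]_p) (t : R) i j :
  (forall s, M s \in unitmx) ->
  (forall i j, derivable (fun s => M s i j) t 1) ->
  derivable (fun s => (invmx (M s)) i j) t 1.
Proof.
move=> U H.
rewrite (_ : (fun _ => _) = (fun s => (\det (M s))^-1) * ((fun s => \adj (M s) i j))); last first.
  by apply/funext => s; rewrite /invmx U mxE.
apply: derivableM.
  apply: (@derivableV _ _ (fun s => \det (M s))); first by have := U t; rewrite unitmxE unitfE.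
  exact: derivable_det.
rewrite (_ : (fun _ => _) = (cst ((-1) ^+ (j + i))) *
  (fun s => \det (row' j (col' i (M s))))); last first.
  by apply/funext => s; rewrite !mxE.
apply: derivableM; first exact: derivable_cst.
apply: derivable_det => k l.
rewrite (_ : (fun _ => _) = (fun s => M s (lift j k) (lift i l))); first exact: H.
by apply/funext => s; rewrite !mxE.
Qed.

(** The entries of the inverse are derivable by [derivable_invmx]; the value of
the derivative follows by differentiating M M^-1 = 1. *)
Lemma mx_derive_inv p (M : R -> 'M[R]_p) (t : R) M' :
  (forall s, M s \in unitmx) -> mx_derive M t M' ->
  mx_derive (fun s => invmx (M s)) t (- (invmx (M t) *m M' *m invmx (M t))).
Proof.
move=> U HM.
pose D : 'M[R]_p := \matrix_(i, j) 'D_1 (fun s => (invmx (M s)) i j) t.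
have HD : mx_derive (fun s => invmx (M s)) t D.
  move=> i j; rewrite mxE; apply: derivableP; apply: derivable_invmx => // k l.
  by case: (HM k l).
have h1 := mx_derive_mul HM HD.
have h2 : mx_derive (fun s => M s *m invmx (M s)) t 0.
  rewrite (_ : (fun _ => _) = (fun=> 1%:M)); first exact: mx_derive_cst.
  by apply/funext => s; rewrite mulmxV.
have e := mx_derive_uniq h1 h2.
suff -> : - (invmx (M t) *m M' *m invmx (M t)) = D by [].
have : invmx (M t) *m (M' *m invmx (M t) + M t *m D) = 0 by rewrite e mulmx0.
rewrite mulmxDr !mulmxA mulVmx// mul1mx => /eqP.
by rewrite addr_eq0 => /eqP ->; rewrite opprK.
Qed.

Lemma mx_derive_continuous p k (M : R -> 'M[R]_(p, k)) i j :
  (forall t, exists M', mx_derive M t M') -> continuous (fun t : R => M t i j).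
Proof.
move=> H t; apply: differentiable_continuous; apply/derivable1_diffP.
by have [M' HM] := H t; case: (HM i j).
Qed.

End matrix_derivative.

(** * Measurability of matrix-valued functions *)

Section matrix_measurable.
Context {disp : measure_display} {T : measurableType disp} {R : realType}.

Lemma measurable_fun_inv (f : T -> R) : (forall w, f w != 0) ->
  measurable_fun setT f -> measurable_fun setT (fun w => (f w)^-1).
Proof.
move=> f0 mf; pose D := [set x : R | x != 0].
have oD : open D by exact: open_neq.
apply: (@measurable_comp _ _ _ _ _ _ D (@GRing.inv R)).
- exact: open_measurable.
- by move=> _ [w _ <-]; exact: f0.
- apply: open_continuous_measurable_fun => // x /[!inE] x0.
  exact: inv_continuous.
- exact: mf.
Qed.

Definition mx_measurable (p k : nat) (M : T -> 'M[R]_(p, k)) :=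
  forall i j, measurable_fun setT (fun w => M w i j).

Lemma mx_measurable_cst p k (M : 'M[R]_(p, k)) : mx_measurable (fun=> M).
Proof. by move=> i j; exact: measurable_cst. Qed.

Lemma mx_measurableD p k (M K : T -> 'M[R]_(p, k)) :
  mx_measurable M -> mx_measurable K -> mx_measurable (fun w => M w + K w).
Proof.
move=> HM HK i j; under eq_fun do rewrite mxE.
exact: measurable_funD.
Qed.

Lemma mx_measurableZ p k c (M : T -> 'M[R]_(p, k)) :
  mx_measurable M -> mx_measurable (fun w => c *: M w).
Proof.
move=> HM i j; under eq_fun do rewrite mxE.
exact: measurable_funM.
Qed.

Lemma mx_measurable_sum p k (I : finType) (M : I -> T -> 'M[R]_(p, k)) :
  (forall i, mx_measurable (M i)) -> mx_measurable (fun w => \sum_i M i w).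
Proof.
move=> HM i j; under eq_fun do rewrite summxE.
by apply: measurable_sum => l; exact: HM.
Qed.

Lemma mx_measurable_tr p k (M : T -> 'M[R]_(p, k)) :
  mx_measurable M -> mx_measurable (fun w => (M w)^T).
Proof. by move=> HM i j; under eq_fun do rewrite mxE; exact: HM. Qed.

Lemma mx_measurable_mul p k l (M : T -> 'M[R]_(p, k)) (K : T -> 'M[R]_(k, l)) :
  mx_measurable M -> mx_measurable K -> mx_measurable (fun w => M w *m K w).
Proof.
move=> HM HK i j; under eq_fun do rewrite mxE.
by apply: measurable_sum => a; exact: measurable_funM.
Qed.

Lemma measurable_det p (M : T -> 'M[R]_p) :
  mx_measurable M -> measurable_fun setT (fun w => \det (M w)).
Proof.
move=> HM; apply: measurable_sum => s; apply: measurable_funM => //.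
by apply: measurable_prod.
Qed.

Lemma mx_measurable_inv p (M : T -> 'M[R]_p) :
  (forall w, M w \in unitmx) -> mx_measurable M ->
  mx_measurable (fun w => invmx (M w)).
Proof.
move=> U HM i j.
under eq_fun do rewrite /invmx U !mxE.
apply: measurable_funM.
  apply: measurable_fun_inv; last exact: measurable_det.
  by move=> w; rewrite -unitfE -unitmxE; exact: U.
apply: measurable_funM => //; apply: measurable_det => k l.
by under eq_fun do rewrite !mxE; exact: HM.
Qed.

Lemma measurable_dotv p (x y : T -> 'cV[R]_p) :
  mx_measurable x -> mx_measurable y ->
  measurable_fun setT (fun w => dotv (x w) (y w)).
Proof. by move=> mx my; apply: measurable_sum => i; exact: measurable_funM. Qed.

Lemma measurable_sqnorm2 p (x : T -> 'cV[R]_p) :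
  mx_measurable x -> measurable_fun setT (fun w => sqnorm2 (x w)).
Proof.
by move=> mx; apply: measurable_sum => i; exact: measurable_funX.
Qed.

Lemma measurable_frob2 p k (M : T -> 'M[R]_(p, k)) :
  mx_measurable M -> measurable_fun setT (fun w => frob2 (M w)).
Proof.
move=> HM; apply: measurable_sum => i; apply: measurable_sum => j.
exact: measurable_funX.
Qed.

Lemma mx_measurable_reg_inv n m (e : R) (B : T -> 'M[R]_(n, m)) :
  0 < e -> mx_measurable B -> mx_measurable (fun w => reg_inv e (B w)).
Proof.
move=> e0 mB; apply: mx_measurable_inv => [w|]; first exact: reg_gram_unit.
apply: mx_measurableD; last exact: mx_measurable_cst.
by apply: mx_measurable_mul => //; exact: mx_measurable_tr.
Qed.

Lemma mx_measurable_reg_pinv n m (e : R) (B : T -> 'M[R]_(n, m)) :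
  0 < e -> mx_measurable B -> mx_measurable (fun w => reg_pinv e (B w)).
Proof.
move=> e0 mB; apply: mx_measurable_mul; first exact: mx_measurable_tr.
exact: mx_measurable_reg_inv.
Qed.

End matrix_measurable.

(** * Derivatives of the regularized inverse along the entries of a sketch *)

Section rank_one.
Context {R : realType} {n m d : nat} (A : 'M[R]_(n, d)).

(** The derivative of A S^T with respect to the entry (j, b) of S. *)
Definition entry_dir (j : 'I_m) (b : 'I_d) : 'M[R]_(n, m) := A *m (delta_mx j b)^T.

Lemma entry_dirE j b i j' : entry_dir j b i j' = A i b * (j' == j)%:R.
Proof.
rewrite mxE (bigD1 b)//= big1 => [|a ab].
  by rewrite !mxE eqxx andbT addr0.
by rewrite !mxE (negbTE ab) andbF mulr0.
Qed.

Lemma mul_entry_dir r c (X : 'M[R]_(r, n)) (Y : 'M[R]_(m, c)) j b i l :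
  (X *m entry_dir j b *m Y) i l = \sum_p A p b * (X i p * Y j l).
Proof.
rewrite mxE (bigD1 j)//= big1 ?addr0; last first.
  move=> j' j'j; rewrite mxE big1 ?mul0r// => p _.
  by rewrite entry_dirE (negbTE j'j) !mulr0.
rewrite mxE mulr_suml; apply: eq_bigr => p _.
by rewrite entry_dirE eqxx mulr1; ring.
Qed.

Lemma mul_entry_dir_tr r c (X : 'M[R]_(r, m)) (Y : 'M[R]_(n, c)) j b i l :
  (X *m (entry_dir j b)^T *m Y) i l = \sum_p A p b * (X i j * Y p l).
Proof.
have <- : (X *m (entry_dir j b)^T *m Y)^T l i = (X *m (entry_dir j b)^T *m Y) i l.
  by rewrite mxE.
rewrite (trmx_mul (X *m _)) (trmx_mul X) trmxK mulmxA.
by rewrite mul_entry_dir; apply: eq_bigr => p _; rewrite !mxE; ring.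
Qed.

End rank_one.

Section reg_derivative.
Context {R : realType} {n m : nat}.
Variables (e : R) (e0 : 0 < e) (B : R -> 'M[R]_(n, m)) (t : R) (B' : 'M[R]_(n, m)).
Hypothesis dB : mx_derive B t B'.
Local Notation N := (reg_inv e (B t)).
Local Notation Z := (reg_pinv e (B t)).

Lemma mx_derive_reg_inv :
  mx_derive (fun s => reg_inv e (B s)) t
    (- (N *m B' *m Z + Z^T *m B'^T *m N)).
Proof.
have dW : mx_derive (fun s => reg_gram e (B s)) t (B' *m (B t)^T + B t *m B'^T + 0).
  apply: mx_deriveD; last exact: mx_derive_cst.
  by apply: mx_derive_mul => //; exact: mx_derive_tr.
have := mx_derive_inv (fun s => reg_gram_unit (B s) e0) dW.
rewrite addr0 mulmxDr mulmxDl -/(reg_inv e (B t)).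
by rewrite (reg_pinv_tr e (B t)) /reg_pinv !mulmxA.
Qed.

Lemma mx_derive_reg_pinv :
  mx_derive (fun s => reg_pinv e (B s)) t
    (1%:M *m B'^T *m N - (Z *m B' *m Z + (Z *m B t) *m B'^T *m N)).
Proof.
have := mx_derive_mul (mx_derive_tr dB) mx_derive_reg_inv.
rewrite mulmxN mulmxDr mul1mx.
by rewrite (reg_pinv_tr e (B t)) /reg_pinv !mulmxA.
Qed.

End reg_derivative.

(** * Measurability of minimum-norm solutions *)

Section min_norm_measurable.
Context {disp : measure_display} {T : measurableType disp} {R : realType}.

(** On the set where the system is solvable, which is measurable by [solvableP],
the solution is the limit of the regularized ones; elsewhere it is 0. *)
Lemma mx_measurable_min_norm_sol n m (B : T -> 'M[R]_(n, m)) (b : 'cV[R]_n) :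
  mx_measurable B -> mx_measurable (fun w => min_norm_sol (B w) b).
Proof.
move=> mB i j; rewrite ord1 => {j}.
pose f k w := dotv b (reg_inv (eps_ k) (B w) *m b).
have mf k : measurable_fun setT (f k).
  apply: measurable_dotv; first exact: mx_measurable_cst.
  apply: mx_measurable_mul; last exact: mx_measurable_cst.
  apply: mx_measurable_reg_inv => //; exact: eps_gt0.
pose Sol := \bigcup_M \bigcap_k [set w | f k w <= M%:R].
have mSol : measurable Sol.
  apply: bigcupT_measurable => M; apply: bigcapT_measurable => k.
  rewrite -[X in measurable X]setTI; apply: measurable_fun_le => //.
(* the indicator selects the default value 0 where there is no solution *)
pose h k w := \1_Sol w * (reg_pinv (eps_ k) (B w) *m b) i ord0.
apply: (@measurable_fun_cvg _ _ _ _ h).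
  move=> k; apply: measurable_funM; first exact: measurable_indic.
  apply: mx_measurable_mul; last exact: mx_measurable_cst.
  by apply: mx_measurable_reg_pinv => //; exact: eps_gt0.
move=> w _; rewrite /h indicE.
have SolP : Sol w <-> exists y, B w *m y = b.
  split; first by move=> [M _ hM]; apply/solvableP; exists M => k; exact: hM.
  by move=> /solvableP[M hM]; exists M => // k _; exact: hM.
have [wS|wS] := boolP (w \in Sol).
  rewrite inE in wS; have /SolP/solvable_gram[u <-] := wS.
  under eq_fun do rewrite mul1r.
  rewrite min_norm_sol_gram; exact: reg_pinv_cvg.
under eq_fun do rewrite mul0r.
rewrite min_norm_sol_unsolvable; first by rewrite mxE; exact: cvg_cst.
move=> y By; move/negP: wS; apply; rewrite inE; apply/SolP; by exists y.
Qed.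

End min_norm_measurable.

(** * Functions of the sketches through the matrices A S_k^T *)

Section sketches.
Context {R : realType} {n d m q : nat}.
Variable A : 'M[R]_(n, d).
Local Notation entry := ('I_q * ('I_m * 'I_d))%type.
Implicit Types (x : entry -> R) (k : 'I_q) (j : 'I_m) (a : 'I_d).

(** The q sketches are read off one family x of real coordinates, so that
[stein] applies to all their entries at once. *)
Definition sketch x k : 'M[R]_(m, d) := \matrix_(j, a) x (k, (j, a)).
Definition sketched x k : 'M[R]_(n, m) := A *m (sketch x k)^T.

Lemma mx_derive_sketch x k j a k' t :
  mx_derive (fun u => sketch (update x (k, (j, a)) u) k') t
    (if k' == k then delta_mx j a else 0).
Proof.
move=> j' a'.
have -> : (fun u => sketch (update x (k, (j, a)) u) k' j' a') =
   (if (k', (j', a')) == (k, (j, a)) then id else cst (x (k', (j', a')))).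
  by apply/funext => u; rewrite mxE /update; case: ifP.
rewrite !xpair_eqE; case: eqVneq => [_|_] /=; last by rewrite mxE; exact: is_derive_cst.
rewrite mxE; case: (_ && _); [exact: is_derive_id|exact: is_derive_cst].
Qed.

Lemma mx_derive_sketched x k j a k' t :
  mx_derive (fun u => sketched (update x (k, (j, a)) u) k') t
    (if k' == k then entry_dir A j a else 0).
Proof.
have := mx_derive_mul (mx_derive_cst A t) (mx_derive_tr (mx_derive_sketch x k j a k' t)).
rewrite mul0mx add0r; case: eqP => // _.
by rewrite trmx0 mulmx0.
Qed.

(** F is bounded and is a function of the B_k = A S_k^T with bounded continuous
gradient H: by the chain rule the derivative along the entry (j, a) of S_k is
sum_i A i a * dF/dB_k(i,j). Hence the derivative of F in a direction of the
kernel of A is 0, without any reference to F as a function of the B_k. *)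
Definition sketched_gradient (F : (entry -> R) -> R)
    (H : 'I_q -> 'I_m -> 'I_n -> (entry -> R) -> R) : Prop :=
  [/\ measurable_of F /\ (forall k j i, measurable_of (H k j i)),
      exists C, (forall x, `|F x| <= C) /\ (forall k j i x, `|H k j i x| <= C),
      forall x k j a (t : R), is_derive t 1 (fun u => F (update x (k, (j, a)) u))
         (\sum_i A i a * H k j i (update x (k, (j, a)) t)) &
      forall k j i x l, continuous (fun t : R => H k j i (update x l t))].

Lemma entry_eta (l : entry) : exists k j a, l = (k, (j, a)).
Proof. by case: l => k [j a]; exists k, j, a. Qed.

Lemma sketched_gradient_continuous F H x l : sketched_gradient F H ->
  continuous (fun t : R => F (update x l t)).
Proof.
move=> [_ _ dF _] t; have [k [j [a ->]]] := entry_eta l.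
apply: differentiable_continuous; apply/derivable1_diffP.
by case: (dF x k j a t).
Qed.

Lemma measurable_ofD (F G : (entry -> R) -> R) :
  measurable_of F -> measurable_of G -> measurable_of (fun x => F x + G x).
Proof. by move=> mF mG dd T Y mY; apply: measurable_funD; [exact: mF|exact: mG]. Qed.

Lemma measurable_ofM (F G : (entry -> R) -> R) :
  measurable_of F -> measurable_of G -> measurable_of (fun x => F x * G x).
Proof. by move=> mF mG dd T Y mY; apply: measurable_funM; [exact: mF|exact: mG]. Qed.

Lemma measurable_of_cst c : measurable_of (fun _ : entry -> R => c).
Proof. by move=> dd T Y mY; exact: measurable_cst. Qed.

Lemma measurable_of_sum (I : finType) (F : I -> (entry -> R) -> R) :
  (forall i, measurable_of (F i)) -> measurable_of (fun x => \sum_i F i x).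
Proof. by move=> mF dd T Y mY; apply: measurable_sum => i; exact: mF. Qed.

Lemma sketched_gradientM F G H K : sketched_gradient F H -> sketched_gradient G K ->
  sketched_gradient (fun x => F x * G x)
    (fun k j i x => H k j i x * G x + F x * K k j i x).
Proof.
move=> HF HG; have cF x l : continuous (fun t : R => F (update x l t)) by exact: sketched_gradient_continuous HF.
have cG x l : continuous (fun t : R => G (update x l t)) by exact: sketched_gradient_continuous HG.
case: HF => [[mF mH] [C [FC HC]] dF cH]; case: HG => [[mG mK] [D [GD KD]] dG cK].
split.
- split; first exact: measurable_ofM.
  by move=> k j i; apply: measurable_ofD; apply: measurable_ofM.
- have C0 : 0 <= C by apply: le_trans (FC (fun=> 0)).
  have D0 : 0 <= D by apply: le_trans (GD (fun=> 0)).
  exists (C * D + C * D); split => [x|k j i x].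
    rewrite normrM; apply: (@le_trans _ _ (C * D)); first exact: ler_pM.
    by rewrite lerDl mulr_ge0.
  apply: le_trans (ler_normD _ _) _.
  by rewrite !normrM; apply: lerD; apply: ler_pM.
- move=> x k j a t.
  have := is_derive_mul (dF x k j a t) (dG x k j a t).
  move=> h; apply: (is_derive_eq h).
  rewrite mulr_suml mulr_sumr -big_split; apply: eq_bigr => i _ /=; ring.
- move=> k j i x l t; apply: cvgD; apply: cvgM.
  + exact: cH.
  + exact: cG.
  + exact: cF.
  + exact: cK.
Qed.

Lemma sketched_gradient_cst c : sketched_gradient (fun=> c) (fun _ _ _ _ => 0).
Proof.
split.
- by split=> [|*]; exact: measurable_of_cst.
- by exists `|c|; split=> [x|*]; rewrite ?normr0.
- move=> x k j a t; rewrite big1 => [|i _]; last by rewrite mulr0.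
  exact: is_derive_cst.
- by move=> k j i x l t; exact: cvg_cst.
Qed.

Lemma sketched_gradientD F G H K : sketched_gradient F H -> sketched_gradient G K ->
  sketched_gradient (fun x => F x + G x) (fun k j i x => H k j i x + K k j i x).
Proof.
case=> [[mF mH] [C [FC HC]] dF cH]; case=> [[mG mK] [D [GD KD]] dG cK].
split.
- split; first exact: measurable_ofD.
  by move=> k j i; apply: measurable_ofD.
- by exists (C + D); split => *; apply: le_trans (ler_normD _ _) _; apply: lerD.
- move=> x k j a t.
  have h1 := dF x k j a t; have h2 := dG x k j a t.
  apply: (@is_derive_eq _ _ _ ((fun u => F (update x (k, (j, a)) u)) + (fun u => G (update x (k, (j, a)) u)))).
  by rewrite -big_split; apply: eq_bigr => i _ /=; rewrite mulrDr.
- by move=> k j i x l t; apply: cvgD; [exact: cH|exact: cK].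
Qed.

Lemma sketched_gradient_ext F G H K : (forall x, F x = G x) ->
  (forall k j i x, H k j i x = K k j i x) -> sketched_gradient F H -> sketched_gradient G K.
Proof.
move=> /funext -> HK; suff -> : H = K by [].
by apply/funext => k; apply/funext => j; apply/funext => i; apply/funext => x.
Qed.

Lemma sketched_gradientZ c F H : sketched_gradient F H ->
  sketched_gradient (fun x => c * F x) (fun k j i x => c * H k j i x).
Proof.
move=> HF; apply: sketched_gradient_ext (sketched_gradientM (sketched_gradient_cst c) HF) => //.
by move=> k j i x; rewrite mul0r add0r.
Qed.

Lemma sketched_gradient_sum (I : finType) F H :
  (forall i : I, sketched_gradient (F i) (H i)) ->
  sketched_gradient (fun x => \sum_i F i x) (fun k j l x => \sum_i H i k j l x).
Proof.
move=> h; elim: (index_enum I) => [|i s IH].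
  by apply: sketched_gradient_ext (sketched_gradient_cst 0) => *; rewrite big_nil.
by apply: sketched_gradient_ext (sketched_gradientD (h i) IH) => *; rewrite big_cons.
Qed.

Section positive.
Variables (e : R) (e0 : 0 < e).
Definition sketched_inv k x := reg_inv e (sketched x k).
Definition sketched_pinv k x := reg_pinv e (sketched x k).
Definition sketched_proj k x := sketched_pinv k x *m sketched x k.

Lemma mx_measurable_sketched dd (T : measurableType dd) (Y : entry -> T -> R) k :
  (forall l, measurable_fun setT (Y l)) -> mx_measurable (fun w => sketched (Y^~ w) k).
Proof.
move=> mY; apply: mx_measurable_mul; first exact: mx_measurable_cst.
apply: mx_measurable_tr => j a; rewrite (_ : (fun _ => _) = Y (k, (j, a))) //.
by apply/funext => w; rewrite mxE.
Qed.

Lemma measurable_of_inv k i l : measurable_of (fun x => sketched_inv k x i l).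
Proof.
move=> dd T Y mY; apply: (mx_measurable_reg_inv e0); exact: mx_measurable_sketched.
Qed.

Lemma measurable_of_pinv k i l : measurable_of (fun x => sketched_pinv k x i l).
Proof.
move=> dd T Y mY; apply: (mx_measurable_reg_pinv e0); exact: mx_measurable_sketched.
Qed.

Lemma measurable_of_proj k i l : measurable_of (fun x => sketched_proj k x i l).
Proof.
move=> dd T Y mY; apply: mx_measurable_mul; last exact: mx_measurable_sketched.
by apply: (mx_measurable_reg_pinv e0); exact: mx_measurable_sketched.
Qed.

Lemma continuous_inv k i l x (c : entry) : continuous (fun t : R => sketched_inv k (update x c t) i l).
Proof.
have [k' [j [a ->]]] := entry_eta c.
apply: (mx_derive_continuous (M := fun t => sketched_inv k (update x (k', (j, a)) t))) => t; eexists.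
by apply: mx_derive_reg_inv => //; exact: mx_derive_sketched.
Qed.

Lemma continuous_pinv k i l x (c : entry) : continuous (fun t : R => sketched_pinv k (update x c t) i l).
Proof.
have [k' [j [a ->]]] := entry_eta c.
apply: (mx_derive_continuous (M := fun t => sketched_pinv k (update x (k', (j, a)) t))) => t; eexists.
by apply: mx_derive_reg_pinv => //; exact: mx_derive_sketched.
Qed.

Lemma continuous_proj k i l x (c : entry) : continuous (fun t : R => sketched_proj k (update x c t) i l).
Proof.
have [k' [j [a ->]]] := entry_eta c.
apply: (mx_derive_continuous (M := fun t => sketched_proj k (update x (k', (j, a)) t))) => t; eexists.
apply: mx_derive_mul; last exact: mx_derive_sketched.
by apply: mx_derive_reg_pinv => //; exact: mx_derive_sketched.
Qed.

(** dN_il / dB_pj = - (N_ip Z_jl + Z_ji N_pl). *)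
Definition sketched_inv_grad k i l : 'I_q -> 'I_m -> 'I_n -> (entry -> R) -> R :=
  fun k' j p x => if k' == k then
     - (sketched_inv k x i p * sketched_pinv k x j l + sketched_pinv k x j i * sketched_inv k x p l) else 0.

(** dZ_jl / dB_pj' = [j = j'] N_pl - Z_jp Z_j'l - (Z B)_jj' N_pl. *)
Definition sketched_pinv_grad k j l : 'I_q -> 'I_m -> 'I_n -> (entry -> R) -> R :=
  fun k' j' p x => if k' == k then
     (j' == j)%:R * sketched_inv k x p l - (sketched_pinv k x j p * sketched_pinv k x j' l + sketched_proj k x j j' * sketched_inv k x p l)
   else 0.

(** A common bound for the entries of N, Z and Z B. *)
Definition entry_bound : R := 2 + (1 + e ^- 2) + (1 + e^-1).

Let ei0 : 0 < e^-1. Proof. by rewrite invr_gt0. Qed.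
Let ei20 : 0 < e ^- 2. Proof. by rewrite invr_gt0 exprn_gt0. Qed.

Lemma entry_bound_ge1 : 1 <= entry_bound.
Proof.
by rewrite /entry_bound; have := ei0; have := ei20; lra.
Qed.

Lemma sketched_inv_bound k x i l : `|sketched_inv k x i l| <= entry_bound.
Proof.
apply: le_trans (reg_inv_bound _ e0 _ _) _; rewrite /entry_bound.
by have := ei0; have := ei20; lra.
Qed.

Lemma sketched_pinv_bound k x i l : `|sketched_pinv k x i l| <= entry_bound.
Proof.
apply: le_trans (reg_pinv_bound _ e0 _ _) _; rewrite /entry_bound.
by have := ei0; have := ei20; lra.
Qed.

Lemma sketched_proj_bound k x i l : `|sketched_proj k x i l| <= entry_bound.
Proof.
apply: le_trans (reg_proj_bound _ e0 _ _) _; rewrite /entry_bound.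
by have := ei0; have := ei20; lra.
Qed.

Lemma mul_entry_bound (a b : R) : `|a| <= entry_bound -> `|b| <= entry_bound -> `|a * b| <= entry_bound ^+ 2.
Proof. by move=> ha hb; rewrite normrM expr2 ler_pM. Qed.

Lemma entry_bound_le_sqr : entry_bound <= entry_bound ^+ 2.
Proof. by have := entry_bound_ge1; nra. Qed.

Lemma sketched_gradient_inv k i l : sketched_gradient (fun x => sketched_inv k x i l) (sketched_inv_grad k i l).
Proof.
split.
- split; first exact: measurable_of_inv.
  move=> k' j p; rewrite /sketched_inv_grad; case: eqP => _; last exact: measurable_of_cst.
  move=> dd T Y mY; apply: measurableT_comp => //.
  by apply: measurable_funD; apply: measurable_funM;
    apply: measurable_of_inv || apply: measurable_of_pinv.
- exists (entry_bound ^+ 2 + entry_bound ^+ 2); split=> [x|k' j p x].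
    apply: le_trans (sketched_inv_bound _ _ _ _) _; apply: le_trans entry_bound_le_sqr _.
    by rewrite lerDl sqr_ge0.
  rewrite /sketched_inv_grad; case: eqP => _; last by rewrite normr0 addr_ge0 ?sqr_ge0.
  rewrite normrN; apply: le_trans (ler_normD _ _) _; apply: lerD; apply: mul_entry_bound;
    exact: sketched_inv_bound || exact: sketched_pinv_bound.
- move=> x k' j a t.
  have h := mx_derive_reg_inv e0 (mx_derive_sketched x k' j a k t) i l.
  apply: (is_derive_eq h).
  rewrite /sketched_inv_grad [k' == k]eq_sym; case: eqP => _; last first.
    rewrite big1 => [|p _]; last by rewrite mulr0.
    by rewrite trmx0 !(mulmx0, mul0mx) addr0 oppr0 mxE.
  rewrite mxE [X in - X]mxE mul_entry_dir mul_entry_dir_tr -big_split -sumrN.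
  apply: eq_bigr => p _ /=; rewrite [(reg_pinv _ _)^T _ _]mxE /sketched_inv /sketched_pinv; ring.
- move=> k' j p x c t; rewrite /sketched_inv_grad; case: eqP => _; last exact: cvg_cst.
  apply: cvgN; apply: cvgD; apply: cvgM;
    exact: continuous_inv || exact: continuous_pinv.
Qed.

Lemma sketched_gradient_pinv k j l : sketched_gradient (fun x => sketched_pinv k x j l) (sketched_pinv_grad k j l).
Proof.
split.
- split; first exact: measurable_of_pinv.
  move=> k' j' p; rewrite /sketched_pinv_grad; case: eqP => _; last exact: measurable_of_cst.
  move=> dd T Y mY; apply: measurable_funB.
    by apply: measurable_funM => //; apply: measurable_of_inv.
  by apply: measurable_funD; apply: measurable_funM;
    first [apply: measurable_of_inv | apply: measurable_of_pinv | apply: measurable_of_proj].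
- exists (entry_bound ^+ 2 + (entry_bound ^+ 2 + entry_bound ^+ 2)); split=> [x|k' j' p x].
    apply: le_trans (sketched_pinv_bound _ _ _ _) _; apply: le_trans entry_bound_le_sqr _.
    by rewrite lerDl addr_ge0 ?sqr_ge0.
  rewrite /sketched_pinv_grad; case: eqP => _; last by rewrite normr0 !addr_ge0 ?sqr_ge0.
  apply: le_trans (ler_normB _ _) _; apply: lerD.
    apply: mul_entry_bound; last exact: sketched_inv_bound.
    by apply: le_trans entry_bound_ge1; case: eqP => _; rewrite ?normr1 ?normr0.
  apply: le_trans (ler_normD _ _) _; apply: lerD; apply: mul_entry_bound;
    first [exact: sketched_inv_bound | exact: sketched_pinv_bound | exact: sketched_proj_bound].
- move=> x k' j' a t.
  have h := mx_derive_reg_pinv e0 (mx_derive_sketched x k' j' a k t) j l.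
  apply: (is_derive_eq h).
  rewrite /sketched_pinv_grad [k' == k]eq_sym; case: eqP => _; last first.
    rewrite big1 => [|p _]; last by rewrite mulr0.
    by rewrite trmx0 !(mulmx0, mul0mx) addr0 subr0 mxE.
  rewrite mxE [X in _ + X]mxE [X in _ - X]mxE mul_entry_dir !mul_entry_dir_tr.
  rewrite -big_split -sumrB; apply: eq_bigr => p _ /=.
  rewrite mxE /sketched_proj /sketched_inv /sketched_pinv [j == j']eq_sym; ring.
- move=> k' j' p x c t; rewrite /sketched_pinv_grad; case: eqP => _; last exact: cvg_cst.
  apply: cvgB.
    by apply: cvgM; [exact: cvg_cst|exact: continuous_inv].
  apply: cvgD; apply: cvgM;
    first [exact: continuous_inv | exact: continuous_pinv | exact: continuous_proj].
Qed.

End positive.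
End sketches.

(** * Identities for the regularized solutions *)

Section identities.
Context {disp : measure_display} {T : measurableType disp} {R : realType}.
Variables (P : probability T R) (n d m q : nat) (A : 'M[R]_(n, d)).
Local Notation entry := ('I_q * ('I_m * 'I_d))%type.
Variables (X : entry -> T -> R) (s : R).
Hypothesis s0 : s != 0.
Hypothesis mX : forall i, measurable_fun setT (X i).
Hypothesis indX : mutually_independent P (fun i => sigma_fun (X i)).
Hypothesis lawX : forall i (B : set R), measurable B ->
  P (X i @^-1` B) = normal_prob 0 s B.
Local Notation x_ w := (X^~ w).

Lemma norm_coord_le (x : entry -> R) l : `|x l| <= \sum_j `|x j|.
Proof. by rewrite (bigD1 l)//= lerDl sumr_ge0. Qed.

Lemma is_derive_coord (x : entry -> R) i l (t : R) :
  is_derive t 1 (fun u => update x i u l) ((l == i)%:R).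
Proof.
rewrite /update; case: eqVneq => _; [exact: is_derive_id|exact: is_derive_cst].
Qed.

Lemma continuous_coord (x : entry -> R) i l : continuous (fun u : R => update x i u l).
Proof. by rewrite /update; case: eqVneq => _ t; [exact: cvg_id|exact: cvg_cst]. Qed.

Lemma continuous_big_sum (I : finType) (f : I -> R -> R) :
  (forall i, continuous (f i)) -> continuous (fun t : R => \sum_i f i t).
Proof.
move=> cf; elim: (index_enum I) => [|i r IH].
  rewrite (_ : (fun _ => _) = cst 0); first by move=> t; exact: cvg_cst.
  by apply/funext => t; rewrite big_nil.
rewrite (_ : (fun _ => _) = (fun t => f i t + \sum_(j <- r) f j t)).
  by move=> t; apply: cvgD; [exact: cf|exact: IH].
by apply/funext => t; rewrite big_cons.
Qed.

Lemma stein_sketched k j a F H : sketched_gradient A F H ->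
  mean_zero P (fun w => X (k, (j, a)) w * F (x_ w) -
    s ^+ 2 * \sum_i A i a * H k j i (x_ w)).
Proof.
move=> [[mF mH] [C [FC HC]] dF cH].
have C0 : 0 <= C by apply: le_trans (FC (fun=> 0)).
have S0 (x : entry -> R) : 0 <= \sum_l `|x l| by exact: sumr_ge0.
have S1 (x : entry -> R) : 1 <= 1 + \sum_l `|x l| by rewrite lerDl.
apply: (stein s0 mX indX lawX (F := F) (G := fun x => \sum_i A i a * H k j i x)).
- exact: mF.
- apply: measurable_of_sum => i.
  by apply: measurable_ofM; [exact: measurable_of_cst|exact: mH].
- exists C => x; apply: le_trans (FC x) _.
  by rewrite ler_peMr.
-  exists (\sum_i `|A i a| * C) => x.
  apply: le_trans (ler_norm_sum _ _ _) _; apply: (@le_trans _ _ (\sum_i `|A i a| * C)).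
    by apply: ler_sum => i _; rewrite normrM ler_wpM2l.
  by rewrite ler_peMr// sumr_ge0// => i _; rewrite mulr_ge0.
- move=> x; apply: continuous_big_sum => i t.
  by apply: cvgM; [exact: cvg_cst|exact: cH].
Qed.

(** The product rule adds the term in which the coordinate [X l] itself is
differentiated. *)
Lemma stein_coord_sketched k j a (l : entry) F H : sketched_gradient A F H ->
  mean_zero P (fun w => X (k, (j, a)) w * (X l w * F (x_ w)) -
    s ^+ 2 * ((l == (k, (j, a)))%:R * F (x_ w) +
              X l w * \sum_i A i a * H k j i (x_ w))).
Proof.
move=> HF; have cF x c : continuous (fun t : R => F (update x c t)).
  exact: sketched_gradient_continuous HF.
case: HF => [[mF mH] [C [FC HC]] dF cH].
have C0 : 0 <= C by apply: le_trans (FC (fun=> 0)).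
have S0 (x : entry -> R) : 0 <= \sum_l `|x l| by exact: sumr_ge0.
have mcoord : measurable_of (fun x : entry -> R => x l) by move=> dd T' Y; exact.
pose G (x : entry -> R) := (l == (k, (j, a)))%:R * F x + x l * \sum_i A i a * H k j i x.
have mG : measurable_of (fun x => \sum_i A i a * H k j i x).
  apply: measurable_of_sum => i.
  by apply: measurable_ofM; [exact: measurable_of_cst|exact: mH].
apply: (stein s0 mX indX lawX (F := fun x => x l * F x) (G := G)).
- exact: measurable_ofM.
- apply: measurable_ofD; apply: measurable_ofM.
  + exact: measurable_of_cst.
  + exact: mF.
  + exact: mcoord.
  + exact: mG.
- exists C => x; rewrite normrM mulrC; apply: ler_pM => //.
  by apply: le_trans (norm_coord_le x l) _; rewrite lerDr.
- exists (C + \sum_i `|A i a| * C) => x.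
  have A0 : 0 <= \sum_i `|A i a| * C by rewrite sumr_ge0// => i _; rewrite mulr_ge0.
  apply: le_trans (ler_normD _ _) _; rewrite mulrDl; apply: lerD.
    rewrite normrM; apply: (@le_trans _ _ (1 * C)).
      by apply: ler_pM => //; case: eqP; rewrite ?normr1 ?normr0.
    by rewrite mul1r ler_peMr// lerDl.
  rewrite normrM mulrC; apply: ler_pM => //.
    apply: le_trans (ler_norm_sum _ _ _) _.
    by apply: ler_sum => i _; rewrite normrM ler_wpM2l.
  by apply: le_trans (norm_coord_le x l) _; rewrite lerDr.
- move=> x t; have h := is_derive_mul (is_derive_coord x (k, (j, a)) l t) (dF x k j a t).
  exact: h.
- move=> x t; apply: cvgD; apply: cvgM.
  + exact: cvg_cst.
  + exact: cF.
  + exact: continuous_coord.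
  + apply: continuous_big_sum => i t'.
    by apply: cvgM; [exact: cvg_cst|exact: cH].
Qed.

Section orthogonal.
Variable Q : 'M[R]_d.
Hypothesis AQ : A *m Q = 0.

(** Sum [stein_coord_sketched] over the entries b of the j-th row of S_k with
weights Q b a: the derivatives of F contribute only through A Q = 0. *)
Lemma stein_orthogonal k j a k' j' a' F H : sketched_gradient A F H ->
  mean_zero P (fun w =>
    (sketch (x_ w) k *m Q) j a * sketch (x_ w) k' j' a' * F (x_ w)
    - s ^+ 2 * (((k' == k) && (j' == j))%:R * Q a' a * F (x_ w))).
Proof.
move=> HF; pose l : entry := (k', (j', a')).
apply: (mean_zero_ext (f := fun w => \sum_b Q b a *
   (X (k, (j, b)) w * (X l w * F (x_ w)) -
    s ^+ 2 * ((l == (k, (j, b)))%:R * F (x_ w) +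
              X l w * \sum_i A i b * H k j i (x_ w))))); last first.
  by apply: mean_zero_sum => b; apply: mean_zeroZ; exact: stein_coord_sketched.
move=> w /=.
transitivity ((\sum_b X (k, (j, b)) w * Q b a) * (X l w * F (x_ w)) -
   s ^+ 2 * ((\sum_b (l == (k, (j, b)))%:R * Q b a) * F (x_ w) +
      X l w * \sum_i (A *m Q) i a * H k j i (x_ w))).
  rewrite mulr_suml mulr_suml.
  have -> : \sum_i (A *m Q) i a * H k j i (x_ w) =
     \sum_b Q b a * \sum_i A i b * H k j i (x_ w).
    under eq_bigr do rewrite mxE mulr_suml.
    rewrite exchange_big; apply: eq_bigr => b _.
    by rewrite mulr_sumr; apply: eq_bigr => i _; ring.
  rewrite mulr_sumr -big_split mulr_sumr -sumrB; apply: eq_bigr => b _ /=; ring.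
rewrite AQ [X in _ - _ * (_ + _ * X)]big1 ?mulr0 ?addr0; last first.
  by move=> i _; rewrite mxE mul0r.
congr (_ - _ * (_ * _)).
  rewrite [in RHS]mxE mulrA; congr (_ * _ * _); last by rewrite mxE.
  by apply: eq_bigr => b _; rewrite mxE.
rewrite (bigD1 a')//= big1 ?addr0 => [|b ba].
  by rewrite !xpair_eqE eqxx andbT.
by rewrite !xpair_eqE [a' == b]eq_sym (negbTE ba) !andbF mul0r.
Qed.

End orthogonal.

Section wishart.
Variables (e : R) (k : 'I_q) (c r : 'cV[R]_n).
Hypothesis e0 : 0 < e.
Hypothesis Kr : A *m A^T *m r = c.

(** [stein_sketched] for the entries of Z c, weighted by those of A^T r. On the
left, r^T A S^T Z c = r^T (1 - e N) c. On the right stands the divergence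
sum_j dZ_jl / dB_ij = m N - Z^T Z - tr(Z B) N, where Z^T Z = N - e N^2 and
tr(Z B) = n - e tr N: the coefficient m - 1 - n of N appears together with
two error terms that are nonnegative as quadratic forms. *)
Lemma mean_inverse_wishart :
  mean_zero P (fun w => let N := sketched_inv A e k (x_ w) in
    dotv r c - e * dotv r (N *m c)
    - s ^+ 2 * ((m%:R - n%:R - 1) * dotv c (N *m c)
       + e * dotv c (N *m N *m c) + e * \tr N * dotv c (N *m c))).
Proof.
pose zF j (x : entry -> R) := \sum_l c l ord0 * sketched_pinv A e k x j l.
pose zH j k' j' p (x : entry -> R) := \sum_l c l ord0 * sketched_pinv_grad A e k j l k' j' p x.
have HZ j : sketched_gradient A (zF j) (zH j).
  by apply: sketched_gradient_sum => l; apply: sketched_gradientZ; exact: sketched_gradient_pinv.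
apply: (mean_zero_ext (f := fun w => \sum_j \sum_a (A^T *m r) a ord0 *
  (X (k, (j, a)) w * zF j (x_ w) -
    s ^+ 2 * \sum_i A i a * zH j k j i (x_ w)))); last first.
  apply: mean_zero_sum => j; apply: mean_zero_sum => a; apply: mean_zeroZ.
  exact: stein_sketched.
move=> w /=; set x := x_ w; set N := sketched_inv A e k x; set Z := sketched_pinv A e k x.
set B := sketched A x k.
have zE j : zF j x = (Z *m c) j ord0.
  by rewrite mxE; apply: eq_bigr => l _; rewrite mulrC.
have e1 : \sum_j \sum_a (A^T *m r) a ord0 * (X (k, (j, a)) w * zF j x) =
   dotv r c - e * dotv r (N *m c).
  transitivity (dotv (A^T *m r) ((sketch x k)^T *m (Z *m c))).
    rewrite /dotv exchange_big; apply: eq_bigr => a _ /=.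
    rewrite [((sketch x k)^T *m _) a ord0]mxE mulr_sumr; apply: eq_bigr => j _.
    by rewrite zE; congr (_ * (_ * _)); rewrite !mxE.
  rewrite dotv_mull trmxK mulmxA -/(sketched A x k) mulmxA -/B.
  by rewrite (mul_reg_pinv B e0) mulmxBl mul1mx dotvDr dotvNr -scalemxAl dotvZr.
have e2 : \sum_j \sum_a (A^T *m r) a ord0 * \sum_i A i a * zH j k j i x =
   \sum_j \sum_i c i ord0 * zH j k j i x.
  apply: eq_bigr => j _.
  transitivity (\sum_i (\sum_a A i a * (A^T *m r) a ord0) * zH j k j i x).
    under [RHS]eq_bigr do rewrite mulr_suml.
    rewrite exchange_big; apply: eq_bigr => a _.
    by rewrite mulr_sumr; apply: eq_bigr => i _; ring.
  by apply: eq_bigr => i _; congr (_ * _); rewrite -Kr -mulmxA [in RHS]mxE.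
have e3 : \sum_j \sum_i c i ord0 * zH j k j i x =
   (m%:R - n%:R - 1) * dotv c (N *m c)
       + e * dotv c (N *m N *m c) + e * \tr N * dotv c (N *m c).
  transitivity (\sum_i c i ord0 * \sum_l
     (m%:R * N i l - (Z^T *m Z) i l - \tr (Z *m B) * N i l) * c l ord0).
    rewrite exchange_big; apply: eq_bigr => i _ /=; rewrite -mulr_sumr.
    congr (_ * _); rewrite /zH exchange_big; apply: eq_bigr => l _ /=.
    rewrite -mulr_sumr mulrC; congr (_ * _).
    rewrite /sketched_pinv_grad eqxx sumrB -/N -/Z big_split /=.
    under eq_bigr do rewrite eqxx mul1r.
    rewrite sumr_const card_ord mulr_natl opprD addrA.
    congr (_ - _ - _).
      by rewrite [RHS]mxE; apply: eq_bigr => j _; rewrite [in RHS]mxE.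
    by rewrite mulr_suml; apply: eq_bigr => j _.
  have trY : \tr (Z *m B) = n%:R - e * \tr N.
    rewrite mxtrace_mulC (mul_reg_pinv B e0) linearB /= mxtrace1.
    by rewrite linearZ.
  have ZZ : Z^T *m Z = N - e *: (N *m N).
    rewrite (reg_pinv_tr e B) -mulmxA (mul_reg_pinv B e0) mulmxBr mulmx1.
    by rewrite -scalemxAr.
  transitivity (dotv c ((m%:R *: N - (N - e *: (N *m N)) - (n%:R - e * \tr N) *: N) *m c)).
    apply: eq_bigr => i _; congr (_ * _); rewrite [RHS]mxE; apply: eq_bigr => l _.
    by congr (_ * _); rewrite ZZ trY [in RHS]mxE; do 3 rewrite mxE; rewrite !mxE; ring.
  rewrite !mulmxBl !(dotvDr, dotvNr) -!scalemxAl !dotvZr; ring.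
rewrite -e3 -e1 -e2 mulr_sumr -sumrB; apply: eq_bigr => j _.
by rewrite mulr_sumr -sumrB; apply: eq_bigr => a _; ring.
Qed.

End wishart.
End identities.

(** * Passage to the limit *)

Section limits.
Context {R : realType}.

Lemma cvg_big_sum (I : finType) (f : I -> nat -> R) (l : I -> R) :
  (forall i, f i @ \oo --> l i) -> (fun k => \sum_i f i k) @ \oo --> \sum_i l i.
Proof.
move=> h; elim: (index_enum I) => [|i r IH].
  rewrite big_nil (_ : (fun _ => _) = cst 0); first exact: cvg_cst.
  by apply/funext => k; rewrite big_nil.
rewrite big_cons (_ : (fun _ => _) = (fun k => f i k + \sum_(j <- r) f j k)).
  by apply: cvgD; [exact: h|exact: IH].
by apply/funext => k; rewrite big_cons.
Qed.

Lemma cvg_dotv p (x y : nat -> 'cV[R]_p) (a b : 'cV[R]_p) :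
  (forall i, (fun k => x k i ord0) @ \oo --> a i ord0) ->
  (forall i, (fun k => y k i ord0) @ \oo --> b i ord0) ->
  (fun k => dotv (x k) (y k)) @ \oo --> dotv a b.
Proof. by move=> hx hy; apply: cvg_big_sum => i; exact: cvgM. Qed.

End limits.

Section almost_sure.
Context {disp : measure_display} {T : measurableType disp} {R : realType}.
Variables (P : probability T R) (n d m q : nat) (A : 'M[R]_(n, d)).
Local Notation entry := ('I_q * ('I_m * 'I_d))%type.
Variables (X : entry -> T -> R) (s : R).
Hypothesis s0 : s != 0.
Hypothesis mX : forall i, measurable_fun setT (X i).
Hypothesis indX : mutually_independent P (fun i => sigma_fun (X i)).
Hypothesis lawX : forall i (B : set R), measurable B ->
  P (X i @^-1` B) = normal_prob 0 s B.
Hypothesis Ku : A *m A^T \in unitmx.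
Hypothesis hm : (n + 1 < m)%N.
Local Notation x_ w := (X^~ w).
Implicit Types (c r : 'cV[R]_n) (i : nat) (k : 'I_q) (w : T).
Local Notation B_ k w := (sketched A (x_ w) k).
Local Notation N i k w := (sketched_inv A (eps_ i) k (x_ w)).
Local Notation Z i k w := (sketched_pinv A (eps_ i) k (x_ w)).
Local Notation zhat_ k c w := (min_norm_sol (B_ k w) c).

Let mn : 0 < m%:R - n%:R - 1 :> R.
Proof. by rewrite -addrA -opprD natr1 subr_gt0 ltr_nat -addn1. Qed.

Let s2 : 0 < s ^+ 2. Proof. by rewrite exprn_even_gt0. Qed.

Lemma mx_measurable_sketched_at k : mx_measurable (fun w => B_ k w).
Proof. exact: mx_measurable_sketched. Qed.

Lemma mx_measurable_inv_at i k : mx_measurable (fun w => N i k w).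
Proof. by apply: mx_measurable_reg_inv; [exact: eps_gt0|exact: mx_measurable_sketched_at]. Qed.

Lemma mx_measurable_inv_mul i k (c : 'cV[R]_n) : mx_measurable (fun w => N i k w *m c).
Proof. by apply: mx_measurable_mul; [exact: mx_measurable_inv_at|exact: mx_measurable_cst]. Qed.

Lemma mx_measurable_zhat k c : mx_measurable (fun w => zhat_ k c w).
Proof. by apply: mx_measurable_min_norm_sol; exact: mx_measurable_sketched_at. Qed.

Lemma measurable_sqnorm2_zhat k c : measurable_fun setT (fun w => sqnorm2 (zhat_ k c w)).
Proof. exact: measurable_sqnorm2 (mx_measurable_zhat k c). Qed.

Lemma quad_ge0 i k c w : 0 <= dotv c (N i k w *m c).
Proof. exact: reg_inv_quad_ge0 (eps_gt0 i) c. Qed.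

Lemma integrable_quad i k c : integrableR P (fun w => dotv c (N i k w *m c)).
Proof.
apply: (@integrableR_bounded _ _ _ P _ ((eps_ i)^-1 * sqnorm2 c)).
  by apply: measurable_dotv; [exact: mx_measurable_cst|exact: mx_measurable_inv_mul].
move=> w; rewrite ger0_norm ?quad_ge0// ler_pdivlMl ?eps_gt0//.
exact: reg_inv_quad_le (eps_gt0 i) c.
Qed.

(** The quantity c^T K^-1 c, which is the squared norm of the minimum-norm
solution of A x = c. *)
Definition min_sqnorm (c : 'cV[R]_n) : R := dotv (invmx (A *m A^T) *m c) c.

Lemma cross_le i k (r c : 'cV[R]_n) w :
  `|eps_ i * dotv r (N i k w *m c)| <= (sqnorm2 r + sqnorm2 c) / 2.
Proof.
rewrite -dotvZr; apply: le_trans (dotv_le _ _) _.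
rewrite ler_pM2r// lerD2l sqnorm2Z.
exact: sqnorm2_reg_inv_le (eps_gt0 i) c.
Qed.

Lemma quad2E i k c w : dotv c (N i k w *m N i k w *m c) = sqnorm2 (N i k w *m c).
Proof. by rewrite -mulmxA dotv_mulr /sketched_inv reg_inv_tr sqnorm2E. Qed.

Lemma tr_inv_ge0 i k w : 0 <= \tr (N i k w).
Proof. exact: tr_reg_inv_ge0 _ (eps_gt0 i). Qed.

(** In [mean_inverse_wishart] the error terms have the good sign, and
e r^T N c is bounded. *)
Lemma quad_expectation_bounded k c :
  exists C, forall i, \int[P]_w dotv c (N i k w *m c) <= C.
Proof.
pose r := invmx (A *m A^T) *m c.
have Kr : A *m A^T *m r = c by rewrite mulmxA mulmxV// mul1mx.
pose C0 := min_sqnorm c + (sqnorm2 r + sqnorm2 c) / 2.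
pose D := s ^+ 2 * (m%:R - n%:R - 1).
have D0 : 0 < D by rewrite mulr_gt0.
exists (D^-1 * C0) => i.
have W := mean_inverse_wishart s0 mX indX lawX k (eps_gt0 i) Kr.
apply: (Rintegral_le_mean_zero (integrable_quad i k c) (mean_zeroZ D^-1 W)) => w /=.
rewrite -mulrBr ler_pdivlMl// /C0 /D -/r -/(min_sqnorm c).
set Q := dotv c (sketched_inv A _ k _ *m c).
have := cross_le i k r c w; rewrite ler_norml => /andP[h _].
have p1 : 0 <= eps_ i * dotv c (N i k w *m N i k w *m c).
  by rewrite quad2E mulr_ge0 ?sqnorm2_ge0// ltW// eps_gt0.
have p2 : 0 <= eps_ i * \tr (N i k w) * Q.
  by rewrite mulr_ge0 ?quad_ge0// mulr_ge0 ?tr_inv_ge0// ltW// eps_gt0.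
have := mulr_ge0 (ltW s2) p1; have := mulr_ge0 (ltW s2) p2.
move: h; set a := eps_ i * dotv r _; set b := eps_ i * dotv c _; set b' := _ * Q.
rewrite /min_sqnorm -/r; lra.
Qed.

Lemma quad_deltaE i k l w :
  dotv (delta_mx l ord0) (N i k w *m delta_mx l ord0) = N i k w l l.
Proof. exact: quad_delta. Qed.

Lemma tr_expectation_bounded k :
  exists C, forall i, \int[P]_w \tr (N i k w) <= C.
Proof.
have [C hC] := choice (fun l : 'I_n => quad_expectation_bounded k (delta_mx l ord0)).
exists (\sum_l C l) => i.
have -> : \int[P]_w \tr (N i k w) = \sum_l \int[P]_w dotv (delta_mx l ord0) (N i k w *m delta_mx l ord0).
  { rewrite /mxtrace; under eq_Rintegral do under eq_bigr do rewrite -quad_deltaE.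
  elim: (index_enum _) => [|l r IH].
    rewrite big_nil; under eq_Rintegral do rewrite big_nil.
    by rewrite Rintegral_cst// mul0r.
  rewrite big_cons -IH -RintegralD//.
  - by apply: eq_Rintegral => w _; rewrite big_cons.
  - exact: integrable_quad.
  - elim: r {IH} => [|l' r IH].
      by under eq_fun do rewrite big_nil; exact: integrableR_cst.
    under eq_fun do rewrite big_cons.
    by apply: integrableRD => //; exact: integrable_quad. }
by apply: ler_sum => l _; exact: hC.
Qed.

(** By [tr_reg_inv_singular] the probability that B B^T is singular is at most
e E tr N, and E tr N is bounded uniformly in e. *)
Lemma sketched_unit_ae : {ae P, forall w, forall k, B_ k w *m (B_ k w)^T \in unitmx}.
Proof.
pose D k : set T := [set w | \det (B_ k w *m (B_ k w)^T) = 0].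
have mD k : measurable (D k).
  rewrite -[D k]setTI; apply: (measurable_det _ measurableT (measurable_set1 0)).
  by apply: mx_measurable_mul; [|apply: mx_measurable_tr]; exact: mx_measurable_sketched_at.
have DE k w : D k w <-> B_ k w *m (B_ k w)^T \notin unitmx.
  by rewrite unitmxE unitfE negbK; split => /eqP.
have PD k : P (D k) = 0%E.
  have [C hC] := tr_expectation_bounded k.
  have le i : fine (P (D k)) <= eps_ i * C.
    have itr : integrableR P (fun w => \tr (N i k w)).
      rewrite /mxtrace; apply: integrableR_sum => l.
      by apply: integrableR_ext (integrable_quad i k (delta_mx l ord0)) => w; rewrite quad_deltaE.
    have -> : fine (P (D k)) = \int[P]_w \1_(D k) w.
      by rewrite /Rintegral integral_indic// setIT.
    apply: (@le_trans _ _ (\int[P]_w (eps_ i * \tr (N i k w)))).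
      { apply: le_Rintegral => //.
      - apply: (@integrableR_bounded _ _ _ P _ 1); first exact: measurable_indic.
        by move=> w; rewrite indicE; case: (_ \in _); rewrite ?normr1 ?normr0.
      - exact: integrableRZ.
      - move=> w _; rewrite indicE; case: (boolP (w \in D k)).
          by rewrite inE => /DE; exact: tr_reg_inv_singular (eps_gt0 i).
        by move=> _; rewrite mulr_ge0 ?tr_inv_ge0// ltW// eps_gt0. }
    by rewrite RintegralZl// ler_wpM2l// ltW// eps_gt0.
  have P0 : fine (P (D k)) <= 0.
    have cv : (fun i => eps_ i * C) @ \oo --> 0.
      by rewrite -[X in _ --> X](mul0r C); apply: cvgM; [exact: cvg_eps|exact: cvg_cst].
    rewrite -(cvg_lim _ cv)//; apply: limr_ge; last exact: nearW.
    by apply/cvg_ex; exists 0.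
  rewrite -[P (D k)]fineK ?fin_num_measure//; congr (_%:E).
  by apply/eqP; rewrite eq_le P0 fine_ge0.
apply: (@filter_forall T 'I_q (fun k => [set w | B_ k w *m (B_ k w)^T \in unitmx])) => k.
exists (D k); split; [exact: mD|exact: PD|].
by move=> w /= /negP hw; apply/DE.
Qed.

Section pointwise.
Variables (k : 'I_q) (w : T).
Hypothesis U : B_ k w *m (B_ k w)^T \in unitmx.

Lemma sketched_solvable c : exists u : 'cV[R]_n, B_ k w *m (B_ k w)^T *m u = c.
Proof. by exists (invmx (B_ k w *m (B_ k w)^T) *m c); rewrite mulmxA mulmxV// mul1mx. Qed.

Lemma mul_sketched_zhat c : B_ k w *m zhat_ k c w = c.
Proof. by have [u <-] := sketched_solvable c; rewrite min_norm_sol_gram mulmxA. Qed.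

Lemma quad_le c i : dotv c (N i k w *m c) <= sqnorm2 (zhat_ k c w).
Proof.
have [u <-] := sketched_solvable c; rewrite min_norm_sol_gram.
exact: reg_quad_solvable (eps_gt0 i) u.
Qed.

Lemma quad_cvg c : (fun i => dotv c (N i k w *m c)) @ \oo --> sqnorm2 (zhat_ k c w).
Proof. by have [u <-] := sketched_solvable c; rewrite min_norm_sol_gram; exact: reg_quad_cvg. Qed.

Lemma pinv_cvg c j : (fun i => (Z i k w *m c) j ord0) @ \oo --> zhat_ k c w j ord0.
Proof. by have [u <-] := sketched_solvable c; rewrite min_norm_sol_gram; exact: reg_pinv_cvg. Qed.

Lemma inv_cvg0 c j : (fun i => (eps_ i *: (N i k w *m c)) j ord0) @ \oo --> 0.
Proof. by have [u <-] := sketched_solvable c; exact: reg_inv_cvg0. Qed.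

Lemma sqnorm2_pinv_cvg c : (fun i => sqnorm2 (Z i k w *m c)) @ \oo --> sqnorm2 (zhat_ k c w).
Proof.
under eq_fun do rewrite sqnorm2E.
by rewrite sqnorm2E; apply: cvg_dotv => j; exact: pinv_cvg.
Qed.

Lemma dotv_inv_cvg0 r c : (fun i => eps_ i * dotv r (N i k w *m c)) @ \oo --> 0.
Proof.
have -> : 0 = dotv r 0 by rewrite -(scale0r (0 : 'cV[R]_n)) dotvZr mul0r.
under eq_fun do rewrite -dotvZr.
apply: cvg_dotv => j; first exact: cvg_cst.
by rewrite mxE; exact: inv_cvg0.
Qed.

Lemma quad2_cvg0 c : (fun i => eps_ i * sqnorm2 (N i k w *m c)) @ \oo --> 0.
Proof.
have e i : eps_ i * sqnorm2 (N i k w *m c) =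
    dotv c (N i k w *m c) - sqnorm2 (Z i k w *m c).
  by rewrite (dotv_reg_inv _ (eps_gt0 i)) addrC addKr.
under eq_fun do rewrite e.
rewrite -(subrr (sqnorm2 (zhat_ k c w))).
by apply: cvgB; [exact: quad_cvg|exact: sqnorm2_pinv_cvg].
Qed.

Lemma tr_inv_cvg0 : (fun i => eps_ i * \tr (N i k w)) @ \oo --> 0.
Proof.
have e i : eps_ i * \tr (N i k w) = \sum_l (eps_ i *: (N i k w *m (delta_mx l ord0 : 'cV[R]_n))) l ord0.
  rewrite /mxtrace mulr_sumr; apply: eq_bigr => l _.
  by rewrite [RHS]mxE mulmx_delta.
rewrite (funext e).
have h := @cvg_big_sum R 'I_n
  (fun l i => (eps_ i *: (N i k w *m (delta_mx l ord0 : 'cV[R]_n))) l ord0) (fun=> 0)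
  (fun l => inv_cvg0 _ l).
by rewrite big1 in h.
Qed.

End pointwise.

Lemma integrable_sqnorm2_zhat k c : integrableR P (fun w => sqnorm2 (zhat_ k c w)).
Proof.
have [C hC] := quad_expectation_bounded k c.
apply: (integrableR_fatou (f_ := fun i w => dotv c (N i k w *m c)) (C := C)) => //.
- by move=> i; exact: integrable_quad.
- by move=> i w; exact: quad_ge0.
- exact: measurable_sqnorm2_zhat.
- move: sketched_unit_ae; apply: filterS => w /(_ k) U; exact: quad_cvg.
Qed.

(** The limit of [mean_inverse_wishart]. All terms are dominated by a constant
plus a multiple of |zhat|^2, because e tr N <= n and e |N c|^2 <= c^T N c. *)
Lemma mean_sqnorm2_zhat k c :
  mean_zero P (fun w => min_sqnorm c - s ^+ 2 * ((m%:R - n%:R - 1) * sqnorm2 (zhat_ k c w))).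
Proof.
pose r := invmx (A *m A^T) *m c.
have Kr : A *m A^T *m r = c by rewrite mulmxA mulmxV// mul1mx.
pose V w := sqnorm2 (zhat_ k c w).
pose D := (m%:R - n%:R - 1 : R).
have V0 w : 0 <= V w by exact: sqnorm2_ge0.
apply: (mean_zero_lim (f_ := fun i w =>
    dotv r c - eps_ i * dotv r (N i k w *m c)
    - s ^+ 2 * (D * dotv c (N i k w *m c)
       + eps_ i * dotv c (N i k w *m N i k w *m c)
       + eps_ i * \tr (N i k w) * dotv c (N i k w *m c)))
  (g := fun w => `|min_sqnorm c| + (sqnorm2 r + sqnorm2 c) / 2 +
     s ^+ 2 * (D + 1 + n%:R) * V w)).
- move=> i; exact (mean_inverse_wishart s0 mX indX lawX k (eps_gt0 i) Kr).
- apply: measurable_funB => //; apply: measurable_funM => //.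
  by apply: measurable_funM => //; exact: measurable_sqnorm2_zhat.
- by apply: integrableRD; [exact: integrableR_cst|apply: integrableRZ; exact: integrable_sqnorm2_zhat].
- move: sketched_unit_ae; apply: filterS => w /(_ k) U.
  have -> : min_sqnorm c - s ^+ 2 * (D * sqnorm2 (zhat_ k c w)) =
     dotv r c - 0 - s ^+ 2 * (D * sqnorm2 (zhat_ k c w) + 0 + 0 * sqnorm2 (zhat_ k c w)).
    by rewrite mul0r !addr0 subr0.
  apply: cvgB; first by apply: cvgB; [exact: cvg_cst|exact: dotv_inv_cvg0].
  apply: cvgM; first exact: cvg_cst.
  apply: cvgD; last by apply: cvgM; [exact: tr_inv_cvg0|exact: quad_cvg].
  apply: cvgD; first by apply: cvgM; [exact: cvg_cst|exact: quad_cvg].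
  by under eq_fun do rewrite quad2E; exact: quad2_cvg0.
- move: sketched_unit_ae; apply: filterS => w /(_ k) U i.
  apply: le_trans (ler_normB _ _) _; apply: lerD.
    by apply: le_trans (ler_normB _ _) _; rewrite lerD2l; exact: cross_le.
  have Q0 := quad_ge0 i k c w; have QV := quad_le U c i.
  have e0 := eps_gt0 (R := R) i.
  have p1 : eps_ i * dotv c (N i k w *m N i k w *m c) <= dotv c (N i k w *m c).
    rewrite quad2E (dotv_reg_inv _ e0) lerDr; exact: sqnorm2_ge0.
  have p1' : 0 <= eps_ i * dotv c (N i k w *m N i k w *m c).
    by rewrite quad2E mulr_ge0 ?sqnorm2_ge0// ltW.
  have p2 : eps_ i * \tr (N i k w) <= n%:R by exact: tr_reg_inv_le.
  have p2' : 0 <= eps_ i * \tr (N i k w) by rewrite mulr_ge0 ?tr_inv_ge0// ltW.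
  move: Q0 QV p1 p1' p2 p2'; rewrite -/(V w).
  set Q := dotv c (N i k w *m c); set a := eps_ i * dotv _ _; set b := eps_ i * _.
  move=> Q0 QV p1 p1' p2 p2'.
  have h1 : D * Q <= D * V w by rewrite ler_wpM2l// ltW.
  have h2 : b * Q <= n%:R * V w by exact: ler_pM.
  rewrite ger0_norm; last first.
    by rewrite mulr_ge0 ?(ltW s2)// !addr_ge0// mulr_ge0// ltW.
  rewrite -mulrA ler_wpM2l ?(ltW s2)//.
  have -> : (D + 1 + n%:R) * V w = D * V w + V w + n%:R * V w by ring.
  apply: lerD => //; apply: lerD => //; exact: le_trans p1 QV.
Qed.

Section orthogonal.
Variable Q : 'M[R]_d.
Hypothesis AQ : A *m Q = 0.
Local Notation SQ k w := (sketch (x_ w) k *m Q).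

Lemma stein_orthogonal_pair k j a k' j' a' F H : sketched_gradient A F H ->
  mean_zero P (fun w => SQ k w j a * SQ k' w j' a' * F (x_ w)
    - s ^+ 2 * (((k' == k) && (j' == j))%:R * (Q^T *m Q) a' a * F (x_ w))).
Proof.
move=> HF.
apply: (mean_zero_ext (f := fun w => \sum_b Q b a' *
   (SQ k w j a * sketch (x_ w) k' j' b * F (x_ w)
    - s ^+ 2 * (((k' == k) && (j' == j))%:R * Q b a * F (x_ w))))); last first.
  apply: mean_zero_sum => b; apply: mean_zeroZ.
  exact: (stein_orthogonal s0 mX indX lawX AQ _ _ _ _ _ _ HF).
move=> w /=; rewrite [SQ k' w j' a']mxE [(Q^T *m Q) a' a]mxE.
rewrite !(mulr_sumr, mulr_suml) -sumrB; apply: eq_bigr => b _.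
by rewrite [Q^T a' b]mxE; ring.
Qed.

Lemma sketched_gradient_quad e k c : 0 < e ->
  exists H, sketched_gradient A (fun x : entry -> R => dotv c (sketched_inv A e k x *m c)) H.
Proof.
move=> e0; eexists.
apply: (sketched_gradient_ext (F := fun x => \sum_p \sum_l (c p ord0 * c l ord0) * sketched_inv A e k x p l)); last first.
  apply: sketched_gradient_sum => p; apply: sketched_gradient_sum => l.
  apply: sketched_gradientZ; exact: sketched_gradient_inv.
- by [].
- move=> x; apply: eq_bigr => p _; rewrite [in RHS]mxE mulr_sumr.
  by apply: eq_bigr => l _; ring.
Qed.

Lemma sketched_gradient_pinv_mul e k c j : 0 < e ->
  exists H, sketched_gradient A (fun x : entry -> R => (sketched_pinv A e k x *m c) j ord0) H.
Proof.
move=> e0; eexists.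
apply: (sketched_gradient_ext (F := fun x => \sum_l c l ord0 * sketched_pinv A e k x j l)); last first.
  by apply: sketched_gradient_sum => l; apply: sketched_gradientZ; exact: sketched_gradient_pinv.
- by [].
- by move=> x; rewrite [in RHS]mxE; apply: eq_bigr => l _; ring.
Qed.

Lemma frob2_gram : \sum_a (Q^T *m Q) a a = frob2 Q.
Proof.
rewrite /frob2 exchange_big; apply: eq_bigr => a _; rewrite mxE.
by apply: eq_bigr => b _; rewrite mxE expr2.
Qed.

(** The squared Frobenius norm of S Q behaves as if it were independent of B. *)
Lemma mean_frob_quad i k c :
  mean_zero P (fun w => frob2 (SQ k w) * dotv c (N i k w *m c)
     - s ^+ 2 * (m%:R * frob2 Q) * dotv c (N i k w *m c)).
Proof.
have [H HF] := sketched_gradient_quad k c (eps_gt0 (R := R) i).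
apply: (mean_zero_ext (f := fun w => \sum_j \sum_a
   (SQ k w j a * SQ k w j a * dotv c (N i k w *m c)
    - s ^+ 2 * (((k == k) && (j == j))%:R * (Q^T *m Q) a a * dotv c (N i k w *m c))))); last first.
  apply: mean_zero_sum => j; apply: mean_zero_sum => a.
  exact: (stein_orthogonal_pair _ _ _ _ _ _ HF).
move=> w; move: (dotv c _) => F.
have -> : m%:R * frob2 Q = \sum_(j < m) \sum_a (Q^T *m Q) a a.
  by rewrite sumr_const card_ord frob2_gram mulr_natl.
rewrite /frob2 mulr_sumr !mulr_suml -sumrB; apply: eq_bigr => j _.
rewrite mulr_sumr !mulr_suml -sumrB; apply: eq_bigr => a _.
by rewrite !eqxx mul1r; ring.
Qed.

Lemma mx_measurable_sketch k : mx_measurable (fun w => sketch (x_ w) k).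
Proof.
move=> j a; rewrite (_ : (fun _ => _) = X (k, (j, a))) //.
by apply/funext => w; rewrite mxE.
Qed.

Lemma mx_measurable_SQ k : mx_measurable (fun w => SQ k w).
Proof. by apply: mx_measurable_mul; [exact: mx_measurable_sketch|exact: mx_measurable_cst]. Qed.

(** The dominating function for [mean_cross]. *)
Lemma integrable_frob_zhat k c :
  integrableR P (fun w => frob2 (SQ k w) * sqnorm2 (zhat_ k c w)).
Proof.
have [C hC] := quad_expectation_bounded k c.
pose K := s ^+ 2 * (m%:R * frob2 Q).
have K0 : 0 <= K by rewrite mulr_ge0 ?(ltW s2)// mulr_ge0// frob2_ge0.
have iK i : integrableR P (fun w => K * dotv c (N i k w *m c)).
  by apply: integrableRZ; exact: integrable_quad.
have fi i : integrableR P (fun w => frob2 (SQ k w) * dotv c (N i k w *m c)).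
  have [h _] := mean_frob_quad i k c.
  apply: (integrableR_ext _ (integrableRD h (iK i))) => w.
  by rewrite /K subrK.
apply: (integrableR_fatou (f_ := fun i w => frob2 (SQ k w) * dotv c (N i k w *m c))
  (C := K * C)).
- exact: fi.
- by move=> i w; rewrite mulr_ge0 ?frob2_ge0 ?quad_ge0.
- move=> i; have [h h0] := mean_frob_quad i k c.
  have -> : \int[P]_w (frob2 (SQ k w) * dotv c (N i k w *m c)) =
     \int[P]_w (K * dotv c (N i k w *m c)).
    move: h0; rewrite RintegralB//; [|exact: fi|exact: iK].
    by move/eqP; rewrite subr_eq0 => /eqP.
  by rewrite RintegralZl ?ler_wpM2l//; exact: integrable_quad.
- apply: measurable_funM; last exact: measurable_sqnorm2_zhat.
  exact: measurable_frob2 (mx_measurable_SQ k).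
- move: sketched_unit_ae; apply: filterS => w /(_ k) U.
  by apply: cvgM; [exact: cvg_cst|exact: quad_cvg].
Qed.

(** [stein_orthogonal_pair] for the products of the entries of Z_k c and
Z_k' c; different sketches are uncorrelated. *)
Lemma mean_cross_reg i k k' c :
  mean_zero P (fun w =>
    dotv ((SQ k w)^T *m (Z i k w *m c)) ((SQ k' w)^T *m (Z i k' w *m c))
    - (k' == k)%:R * (s ^+ 2 * frob2 Q * sqnorm2 (Z i k w *m c))).
Proof.
have e0 := eps_gt0 (R := R) i.
apply: (mean_zero_ext (f := fun w => \sum_a \sum_j \sum_j'
   (SQ k w j a * SQ k' w j' a *
      ((Z i k w *m c) j ord0 * (Z i k' w *m c) j' ord0)
    - s ^+ 2 * (((k' == k) && (j' == j))%:R * (Q^T *m Q) a a *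
      ((Z i k w *m c) j ord0 * (Z i k' w *m c) j' ord0))))); last first.
  apply: mean_zero_sum => a; apply: mean_zero_sum => j; apply: mean_zero_sum => j'.
  have [H1 h1] := sketched_gradient_pinv_mul k c j e0.
  have [H2 h2] := sketched_gradient_pinv_mul k' c j' e0.
  exact: (stein_orthogonal_pair _ _ _ _ _ _ (sketched_gradientM h1 h2)).
move=> w /=; set z := Z i k w *m c; set z' := Z i k' w *m c.
have -> : (k' == k)%:R * (s ^+ 2 * frob2 Q * sqnorm2 z) =
  \sum_a \sum_j \sum_j' s ^+ 2 * (((k' == k) && (j' == j))%:R * (Q^T *m Q) a a *
      (z j ord0 * z' j' ord0)).
  transitivity (\sum_a (k' == k)%:R * (s ^+ 2 * (Q^T *m Q) a a * sqnorm2 z)).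
    by rewrite -mulr_sumr -mulr_suml -mulr_sumr frob2_gram.
  apply: eq_bigr => a _; rewrite /sqnorm2 !mulr_sumr.
  apply: eq_bigr => j _; rewrite (bigD1 j)//= big1 ?addr0.
    rewrite eqxx andbT; case: (eqVneq k' k) => [kk|_]; last by rewrite !mul0r !mulr0.
    by rewrite /z' kk -/z; ring.
  by move=> j' jj; rewrite (negbTE jj) andbF !mul0r mulr0.
rewrite /dotv -sumrB; apply: eq_bigr => a _.
rewrite [((SQ k w)^T *m z) a ord0]mxE [((SQ k' w)^T *m z') a ord0]mxE.
rewrite big_distrlr /= -sumrB; apply: eq_bigr => j _.
rewrite -sumrB; apply: eq_bigr => j' _; congr (_ - _).
by rewrite [(SQ k w)^T a j]mxE [(SQ k' w)^T a j']mxE; ring.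
Qed.

(** |(S_k Q)^T Z_k c|^2 <= |S_k Q|_F^2 |zhat_k|^2 allows the passage to the limit
in [mean_cross_reg]. *)
Lemma mean_cross k k' c :
  mean_zero P (fun w =>
    dotv ((SQ k w)^T *m zhat_ k c w) ((SQ k' w)^T *m zhat_ k' c w)
    - (k' == k)%:R * (s ^+ 2 * frob2 Q * sqnorm2 (zhat_ k c w))).
Proof.
pose K := s ^+ 2 * frob2 Q.
have K0 : 0 <= K by rewrite mulr_ge0 ?(ltW s2)// frob2_ge0.
pose D k w := frob2 (SQ k w) * sqnorm2 (zhat_ k c w).
have mSz k1 : mx_measurable (fun w => (SQ k1 w)^T *m zhat_ k1 c w).
  apply: mx_measurable_mul; last exact: mx_measurable_zhat.
  by apply: mx_measurable_tr; exact: mx_measurable_SQ.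
apply: (mean_zero_lim (f_ := fun i w =>
    dotv ((SQ k w)^T *m (Z i k w *m c)) ((SQ k' w)^T *m (Z i k' w *m c))
    - (k' == k)%:R * (K * sqnorm2 (Z i k w *m c)))
  (g := fun w => 2^-1 * (D k w + D k' w) + K * sqnorm2 (zhat_ k c w))).
- move=> i; exact: mean_cross_reg.
- apply: measurable_funB; first exact: measurable_dotv.
  apply: measurable_funM => //; apply: measurable_funM => //.
  exact: measurable_sqnorm2_zhat.
- apply: integrableRD.
    by apply: integrableRZ; apply: integrableRD; exact: integrable_frob_zhat.
  by apply: integrableRZ; exact: integrable_sqnorm2_zhat.
- move: sketched_unit_ae; apply: filterS => w U.
  have cvS k1 a : (fun i => ((SQ k1 w)^T *m (Z i k1 w *m c)) a ord0) @ \oo -->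
      ((SQ k1 w)^T *m zhat_ k1 c w) a ord0.
    rewrite mxE; under eq_fun do rewrite mxE.
    by apply: cvg_big_sum => j; apply: cvgM; [exact: cvg_cst|exact: pinv_cvg].
  apply: cvgB; first by apply: cvg_dotv => a; exact: cvS.
  apply: cvgM; first exact: cvg_cst.
  by apply: cvgM; [exact: cvg_cst|exact: sqnorm2_pinv_cvg].
- move: sketched_unit_ae; apply: filterS => w U i.
  have ZV k1 : sqnorm2 (Z i k1 w *m c) <= sqnorm2 (zhat_ k1 c w).
    apply: le_trans (quad_le (U k1) c i).
    exact: sqnorm2_reg_pinv_le (eps_gt0 i) c.
  have ZD k1 : sqnorm2 ((SQ k1 w)^T *m (Z i k1 w *m c)) <= D k1 w.
    apply: le_trans (sqnorm2_mulmx_le _ _) _.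
    by rewrite frob2_tr ler_wpM2l ?frob2_ge0.
  apply: le_trans (ler_normB _ _) _; apply: lerD.
    apply: le_trans (dotv_le _ _) _; rewrite mulrC ler_wpM2l ?invr_ge0//.
    exact: lerD.
  rewrite normrM (ger0_norm (mulr_ge0 K0 (sqnorm2_ge0 _))).
  apply: (@le_trans _ _ (1 * (K * sqnorm2 (Z i k w *m c)))).
    rewrite ler_wpM2r ?(mulr_ge0 K0 (sqnorm2_ge0 _))//.
    by case: (k' == k); rewrite ?normr1 ?normr0.
  by rewrite mul1r ler_wpM2l.
Qed.

End orthogonal.

End almost_sure.

(** * All entries of all sketches are independent *)

Section joint_independence.
Context {disp : measure_display} {T : measurableType disp} {R : realType}.

(** An intersection of entry events is grouped by sketch; each group is an event
of the sigma-algebra of that sketch. *)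
Lemma joint_entries_independent (P : probability T R) (q m d : nat)
    (S : 'I_q -> T -> 'M[R]_(m, d)) :
  iid_gaussian_sketches P S ->
  mutually_independent P (fun l : 'I_q * ('I_m * 'I_d) =>
    sigma_fun (fun w => S l.1 w l.2.1 l.2.2)).
Proof.
move=> [gS indS] J E hE.
pose C k := \bigcap_(ij in [set ij | (k, ij) \in J]) E (k, ij).
have CS k : sigma_mx (S k) (C k).
  pose G := \bigcup_(ij in [set: 'I_m * 'I_d]) sigma_fun (fun w => S k w ij.1 ij.2).
  apply: (@fin_bigcap_measurable _ (g_sigma_algebraType G)) => [|ij ijJ].
    exact: finite_finset.
  by apply: sub_sigma_algebra; exists ij => //; exact: (hE (k, ij)).
have -> : \bigcap_(l in [set l | l \in J]) E l = \bigcap_(k in [set k | k \in [set: 'I_q]%SET]) C k.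
  apply/seteqP; split => [w h k _ ij /= ijJ|w h [k ij] /= lJ]; first exact: h.
  by apply: (h k) => //=; rewrite inE.
rewrite (indS _ C (fun k _ => CS k)).
pose Jk k : {set 'I_m * 'I_d} := [set ij | (k, ij) \in J]%SET.
transitivity (\prod_(k in [set: 'I_q]%SET) \prod_(ij in Jk k) P (E (k, ij)))%E.
  apply: eq_bigr => k _; have [_ _ indk] := gS k.
  rewrite -(indk (Jk k) (fun ij => E (k, ij))).
    congr (P _); apply/seteqP; split => w h ij /= hij; apply: h; move: hij;
    by rewrite /= inE.
  by move=> ij; rewrite inE => ijJ; exact: (hE (k, ij)).
rewrite pair_big_dep /=; apply: eq_big => [[k ij]|[k ij] _] //=.
by rewrite !inE.
Qed.

End joint_independence.

(** * The orthogonal projection onto the kernel of A *)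

Section projection.
Context {R : realType} {n d : nat} (A : 'M[R]_(n, d)).
Hypothesis Ku : A *m A^T \in unitmx.
Local Notation K := (A *m A^T).

Definition kernel_proj : 'M[R]_d := 1%:M - A^T *m invmx K *m A.

Lemma mul_kernel_proj : A *m kernel_proj = 0.
Proof. by rewrite mulmxBr mulmx1 !mulmxA mulmxV// mul1mx subrr. Qed.

Lemma kernel_proj_tr : kernel_proj^T = kernel_proj.
Proof.
have KT : K^T = K by rewrite trmx_mul trmxK.
by rewrite /kernel_proj linearB /= trmx1 !trmx_mul trmxK trmx_inv KT mulmxA.
Qed.

(** Q^T Q = Q, and tr Q = d - tr(K^-1 A A^T). *)
Lemma frob2_kernel_proj : frob2 kernel_proj = d%:R - n%:R.
Proof.
rewrite -frob2_gram kernel_proj_tr.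
have -> : kernel_proj *m kernel_proj = kernel_proj.
  by rewrite {1}/kernel_proj mulmxBl mul1mx -(mulmxA _ A) mul_kernel_proj mulmx0 subr0.
change (\tr kernel_proj = d%:R - n%:R).
rewrite /kernel_proj linearB /= mxtrace1 mxtrace_mulC mulmxA mulmxV//.
by rewrite mxtrace1.
Qed.

Lemma kernel_decomp (x : 'cV[R]_d) :
  x = A^T *m (invmx K *m (A *m x)) + kernel_proj *m x.
Proof. by rewrite mulmxBl mul1mx !mulmxA addrC subrK. Qed.

Lemma sqnorm2_kernel_decomp (x : 'cV[R]_d) (b : 'cV[R]_n) : A *m x = b ->
  sqnorm2 x = min_sqnorm A b + sqnorm2 (kernel_proj *m x).
Proof.
move=> Axb; rewrite {1}(kernel_decomp x) Axb sqnorm2D dotv_mull trmxK mulmxA.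
rewrite mul_kernel_proj mul0mx.
rewrite (_ : dotv _ 0 = 0) ?mulr0 ?addr0; last by rewrite dotvE mulmx0 mxE.
congr (_ + _); rewrite -dotv_gram /min_sqnorm [in RHS]dotvC dotvC; congr (dotv _ _).
by rewrite mulmxA mulmxV// mul1mx.
Qed.

Lemma min_norm_sol_full (b : 'cV[R]_n) :
  min_norm_sol A b = A^T *m (invmx K *m b).
Proof.
by rewrite -{1}[b]mul1mx -(mulmxV Ku) -mulmxA min_norm_sol_gram.
Qed.

Lemma sqnorm2_min_norm_sol (b : 'cV[R]_n) : sqnorm2 (min_norm_sol A b) = min_sqnorm A b.
Proof.
rewrite min_norm_sol_full -dotv_gram /min_sqnorm; congr (dotv _ _).
by rewrite mulmxA mulmxV// mul1mx.
Qed.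

Lemma min_sqnorm_gt0 (b : 'cV[R]_n) : b != 0 -> 0 < min_sqnorm A b.
Proof.
move=> b0; rewrite -sqnorm2_min_norm_sol lt_neqAle sqnorm2_ge0 andbT eq_sym.
apply: contra b0 => /eqP/sqnorm2_eq0; rewrite min_norm_sol_full.
move/(congr1 (mulmx A)); rewrite !mulmxA mulmxV// mul1mx mulmx0 => ->.
exact: eqxx.
Qed.

End projection.

(** * The relative error of the averaged sketched solutions *)
Theorem mainTheorem8 (R : realType) (disp : measure_display)
    (T : measurableType disp) (P : probability T R)
    (n d m q : nat) (A : 'M[R]_(n, d)) (b : 'cV[R]_n)
    (S : 'I_q -> T -> 'M[R]_(m, d))
    (hnd : (n < d)%N) (hA : \rank A = n) (hb : b != 0)
    (hm : (n + 1 < m)%N) (hq : (1 <= q)%N)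
    (hS : iid_gaussian_sketches P S) :
  let f := fun x : 'cV[R]_d => sqnorm2 x in
  let xstar := min_norm_sol A b in
  let zhat := fun k w => min_norm_sol (A *m (S k w)^T) b in
  let xhat := fun k w => (S k w)^T *m zhat k w in
  let xbar := fun w => q%:R^-1 *: \sum_(k < q) xhat k w in
  (('E_P[fun w => f (xbar w)] - (f xstar)%:E) / (f xstar)%:E)%E
    = (q%:R^-1 * ((d%:R - n%:R) / (m%:R - n%:R - 1)))%:E
  /\ forall eps : R, 0 < eps ->
     ((1 - (q%:R * eps)^-1 * ((d%:R - n%:R) / (m%:R - n%:R - 1)))%:E
       <= P [set w | ((f (xbar w) - f xstar) / f xstar <= eps)%R])%E.
Proof.
move=> f xstar zhat xhat xbar.
pose X (l : 'I_q * ('I_m * 'I_d)) (w : T) := S l.1 w l.2.1 l.2.2.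
pose s : R := Num.sqrt m%:R^-1.
have m0 : (0 < m)%N by apply: leq_ltn_trans hm.
have s2E : s ^+ 2 = m%:R^-1 by rewrite sqr_sqrtr// invr_ge0.
have s0 : s != 0 by rewrite gt_eqF// sqrtr_gt0 invr_gt0 ltr0n.
have mX l : measurable_fun setT (X l).
  by have [h _ _] := hS.1 l.1; exact: h.
have indX : mutually_independent P (fun l => sigma_fun (X l)).
  exact: joint_entries_independent.
have lawX l (B : set R) : measurable B -> P (X l @^-1` B) = normal_prob 0 s B.
  by have [_ h _] := hS.1 l.1; exact: h.
have Ku : A *m A^T \in unitmx by exact: gram_unit.
have q0 : 0 < q%:R :> R by rewrite ltr0n.
pose D : R := m%:R - n%:R - 1.
have D0 : 0 < D by rewrite /D -addrA -opprD natr1 subr_gt0 ltr_nat -addn1.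
pose Q := kernel_proj A.
have AQ : A *m Q = 0 by exact: mul_kernel_proj.
have QT : Q^T = Q by exact: kernel_proj_tr.
pose a := min_sqnorm A b.
have fE : f xstar = a by exact: sqnorm2_min_norm_sol.
have a0 : 0 < a by exact: min_sqnorm_gt0.
have sketchE k w : sketch (X^~ w) k = S k w by apply/matrixP => i j; rewrite mxE.
have sketchedE k w : sketched A (X^~ w) k = A *m (S k w)^T by rewrite /sketched sketchE.
pose tau : R := frob2 Q.
have tauE : tau = d%:R - n%:R by exact: frob2_kernel_proj.
pose rho : R := q%:R^-1 * ((d%:R - n%:R) / D).
(* Q (q xbar), as Q is symmetric *)
pose y w := \sum_(k < q) ((S k w *m Q)^T *m zhat k w).
have mz_y : mean_zero P (fun w => sqnorm2 (y w) - q%:R * (tau * a / D)).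
  have mz1 : mean_zero P (fun w => \sum_k \sum_k'
      (dotv ((S k w *m Q)^T *m zhat k w) ((S k' w *m Q)^T *m zhat k' w)
       - (k' == k)%:R * (s ^+ 2 * tau * sqnorm2 (zhat k w)))).
    apply: mean_zero_sum => k; apply: mean_zero_sum => k'.
    apply: mean_zero_ext (mean_cross s0 mX indX lawX Ku hm AQ k k' b) => w /=.
    by rewrite !sketchedE !sketchE.
  have mz2 : mean_zero P (fun w => \sum_k (- (tau / D)) *
      (a - s ^+ 2 * (D * sqnorm2 (zhat k w)))).
    apply: mean_zero_sum => k; apply: mean_zeroZ.
    apply: mean_zero_ext (mean_sqnorm2_zhat s0 mX indX lawX Ku hm k b) => w /=.
    by rewrite sketchedE.
  apply: mean_zero_ext (mean_zeroD mz1 mz2) => w /=.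
  rewrite -big_split /=.
  transitivity (\sum_k (\sum_k' dotv ((S k w *m Q)^T *m zhat k w) ((S k' w *m Q)^T *m zhat k' w) - tau * a / D)).
    apply: eq_bigr => k _; rewrite sumrB.
    have -> : \sum_(k' < q) (k' == k)%:R * (s ^+ 2 * tau * sqnorm2 (zhat k w)) =
        s ^+ 2 * tau * sqnorm2 (zhat k w).
      rewrite (bigD1 k)//= eqxx mul1r big1 ?addr0// => k' kk.
      by rewrite (negbTE kk) mul0r.
    by field; rewrite gt_eqF.
  rewrite sumrB sumr_const card_ord [in RHS]mulr_natl; congr (_ - _).
  rewrite sqnorm2E /y; symmetry.
  rewrite /dotv; under eq_bigr do rewrite !summxE big_distrlr /=.
  rewrite exchange_big; apply: eq_bigr => k _ /=.
  by rewrite exchange_big.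
pose g w := (q%:R ^- 2 / a) * sqnorm2 (y w).
have g0 w : 0 <= g w.
  apply: mulr_ge0 (sqnorm2_ge0 _); apply: divr_ge0; last exact: ltW.
  by rewrite invr_ge0 exprn_ge0// ltW.
have mz_g : mean_zero P (fun w => g w - rho).
  apply: mean_zero_ext (mean_zeroZ (q%:R ^- 2 / a) mz_y) => w /=.
  by rewrite mulrBr -/(g w) /rho -tauE; field; rewrite !gt_eqF.
have mxbar : measurable_fun setT (fun w => f (xbar w)).
  apply: measurable_sqnorm2; apply: mx_measurableZ; apply: mx_measurable_sum => k.
  apply: mx_measurable_mul.
    by apply: mx_measurable_tr => i j; exact: (mX (k, (i, j))).
  apply: mx_measurable_min_norm_sol; apply: mx_measurable_mul.
    exact: mx_measurable_cst.
  by apply: mx_measurable_tr => i j; exact: (mX (k, (i, j))).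
have ae_g : {ae P, forall w, (f (xbar w) - f xstar) / f xstar = g w}.
  have := sketched_unit_ae s0 mX indX lawX Ku hm; apply: filterS => w U.
  have Axbar : A *m xbar w = b.
    rewrite -scalemxAr mulmx_sumr (eq_bigr (fun=> b)) => [|k _].
      rewrite sumr_const card_ord -[b *+ q](scaler_nat q b).
      by rewrite scalerA mulVf ?scale1r// gt_eqF.
    by rewrite mulmxA; have := mul_sketched_zhat (U k) b; rewrite sketchedE.
  have Qx : Q *m xbar w = q%:R^-1 *: y w.
    rewrite -scalemxAr mulmx_sumr; congr (_ *: _); apply: eq_bigr => k _.
    by rewrite trmx_mul QT !mulmxA.
  rewrite fE /f (sqnorm2_kernel_decomp Ku Axbar) -/a -/Q Qx sqnorm2Z /g.
  by rewrite addrAC subrr add0r exprVn mulrAC.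
have ae_f : {ae P, forall w, f (xbar w) = a + a * g w}.
  move: ae_g; apply: filterS => w <-; rewrite fE mulrC divfK ?gt_eqF//.
  by rewrite addrC subrK.
have [gi gE] := mean_zeroP mz_g.
split.
  have -> : ('E_P[fun w => f (xbar w)] = (a + a * rho)%:E)%E.
    rewrite unlock.
    transitivity (\int[P]_w (a + a * g w)%:E)%E.
      { apply: ae_eq_integral => //.
      - exact/measurable_EFinP.
      - apply/measurable_EFinP; apply: measurable_funD => //.
        by apply: measurable_funM => //; exact: integrableR_meas gi.
      - by move: ae_f; apply: filterS => w /= ->. }
    have mz : mean_zero P (fun w => a + a * g w - (a + a * rho)).
      by apply: mean_zero_ext (mean_zeroZ a mz_g) => w /=; ring.
    by have [_] := mean_zeroP mz.
  rewrite fE inver gt_eqF// -EFinB -EFinM; congr (_%:E).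
  by rewrite addrAC subrr add0r mulrAC divff ?mul1r// gt_eqF.
move=> eps eps0.
have le := markov_mean_zero eps0 g0 mz_g.
have mle (h : T -> R) : measurable_fun setT h -> measurable [set w | h w <= eps].
  by move=> mh; rewrite -[X in measurable X]setTI; exact: measurable_fun_le.
rewrite (ae_eq_probability (B := [set w | g w <= eps])).
- apply: le_trans le; rewrite lee_fin /rho mulrA invfM (mulrC q%:R^-1).
  exact: lexx.
- apply: mle; apply: measurable_funM => //; exact: measurable_funB.
- by apply: mle; exact: integrableR_meas gi.
- by move: ae_g; apply: filterS => w /= ->.
Qed.
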